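(* Suppose every component $f_i:\mathbb{R}^d\to\mathbb{R}$ ($i=1,\dots,n$, $n\ge 2$) is differentiable with $L$-Lipschitz gradient (components need not be convex), the average $F=\frac1n\sum_{i=1}^n f_i$ is $\mu$-strongly convex with $0<\mu\le L$ and unique minimizer $x_\star$, and $F$ is twice differentiable with $\|\nabla^2F(x)-\nabla^2F(y)\|_{\mathrm{op}}\le\rho\|x-y\|$ for all $x,y\in\mathbb{R}^d$. Suppose random reshuffling is run with constant component stepsize $\eta>0$ satisfying $n\eta\le \frac{\mu}{32L^2}$. Then, for every $K\ge1$, with $T=nK$, $$ \mathbb{E}\|y_K-x_\star\|^2\le \exp\left(-\frac{\mu\eta T}{2}\right)D^2+\frac{64L^2G^2}{\mu^2}\eta^2+\frac{6L^2G^2}{\mu}n^2\eta^3+\frac{8\rho^2G^4}{9\mu^2}n^2\eta^4 . $$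
   Context: Random reshuffling (RR) with constant component stepsize $\eta>0$ starts from a deterministic point $y_0\in\mathbb{R}^d$. At each epoch $k=0,1,\dots,K-1$ it draws a fresh, independent, uniformly random permutation $\pi_k$ of $\{1,\dots,n\}$, sets $x_{k,0}=y_k$, performs $x_{k,i}=x_{k,i-1}-\eta\nabla f_{\pi_k(i)}(x_{k,i-1})$ for $i=1,\dots,n$, and sets $y_{k+1}=x_{k,n}$. Expectations are over the permutations. Constants: $G_\star:=\max_{i}\|\nabla f_i(x_\star)\|$, $D:=\max\{\|y_0-x_\star\|,\,G_\star/(2L)\}$, $G:=G_\star+2LD$. *)

(* Defs.v *)
From HB Require Import structures.
From mathcomp Require Import all_boot all_order all_fingroup all_algebra.
From mathcomp Require Import all_classical all_reals all_analysis.
Set Implicit Arguments.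
Unset Strict Implicit.
Unset Printing Implicit Defensive.
Import Order.TTheory GRing.Theory Num.Theory.
Import numFieldNormedType.Exports.
Local Open Scope classical_set_scope.
Local Open Scope ring_scope.

(* MathComp-Analysis norms 'rV[R]_d with the sup norm, so the Euclidean norm is
   defined here.  Differentiability ([differentiable], ['d], ['J]) comes from
   the library; in finite dimension it does not depend on the norm. *)
Definition enorm (R : realType) (d : nat) (x : 'rV[R]_d) : R :=
  Num.sqrt (\sum_(j < d) x ord0 j ^+ 2).

(* Euclidean operator norm.  Vectors are rows, so A acts by v |-> v *m A. *)
Definition opnorm (R : realType) (d : nat) (A : 'M[R]_d) : R :=
  sup [set enorm (v *m A) | v in [set v : 'rV[R]_d | enorm v <= 1]].

Definition grad (R : realType) (d : nat) (f : 'rV[R]_d -> R) (x : 'rV[R]_d) :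
    'rV[R]_d :=
  \row_(j < d) 'd f x (delta_mx ord0 j).

Definition hessian (R : realType) (d : nat) (f : 'rV[R]_d -> R)
    (x : 'rV[R]_d) : 'M[R]_d :=
  jacobian (grad f) x.

Definition twice_differentiable (R : realType) (d : nat)
    (f : 'rV[R]_d -> R) : Prop :=
  forall x : 'rV[R]_d, differentiable f x /\ differentiable (grad f) x.

Definition lipschitz_gradient (R : realType) (d : nat) (L : R)
    (f : 'rV[R]_d -> R) : Prop :=
  forall x y, enorm (grad f x - grad f y) <= L * enorm (x - y).

Definition strongly_convex (R : realType) (d : nat) (mu : R)
    (f : 'rV[R]_d -> R) : Prop :=
  forall (x y : 'rV[R]_d) (t : R), 0 <= t <= 1 ->
    f (t *: x + (1 - t) *: y) <=
      t * f x + (1 - t) * f y - mu / 2 * t * (1 - t) * enorm (x - y) ^+ 2.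

Definition minimizer (R : realType) (d : nat) (f : 'rV[R]_d -> R)
    (x : 'rV[R]_d) : Prop :=
  forall y, f x <= f y.

Definition unique_minimizer (R : realType) (d : nat) (f : 'rV[R]_d -> R)
    (x : 'rV[R]_d) : Prop :=
  minimizer f x /\ (forall z, minimizer f z -> z = x).

Definition average (R : realType) (d n : nat) (f : 'I_n -> 'rV[R]_d -> R) :
    'rV[R]_d -> R :=
  fun x => n%:R^-1 * \sum_(i < n) f i x.

(* Components are indexed from 0, and [enum 'I_n] lists 0, ..., n-1 in
   increasing order: the i-th step uses the component [p i]. *)
Definition rr_epoch (R : realType) (d n : nat) (f : 'I_n -> 'rV[R]_d -> R)
    (eta : R) (p : 'S_n) (y : 'rV[R]_d) : 'rV[R]_d :=
  foldl (fun x i => x - eta *: grad (f (p i)) x) y (enum 'I_n).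

Fixpoint rr (R : realType) (d n : nat) (f : 'I_n -> 'rV[R]_d -> R) (eta : R)
    (y0 : 'rV[R]_d) (p : nat -> 'S_n) (k : nat) : 'rV[R]_d :=
  if k is k'.+1 then rr_epoch f eta (p k') (rr f eta y0 p k') else y0.

(* sigma 0, ..., sigma (K-1) are random variables on (T, P) (permutations carry
   the discrete sigma-algebra), each uniform on 'S_n, and mutually independent.
   Taking [A k := setT] for some k gives the product rule for subfamilies. *)
Definition iid_uniform_perms (R : realType) (disp : measure_display)
    (T : measurableType disp) (P : probability T R) (n : nat) (K : nat)
    (sigma : nat -> T -> 'S_n) : Prop :=
  [/\ forall (k : 'I_K) (A : {set 'S_n}), measurable [set w | sigma k w \in A],
      forall (k : 'I_K) (s : 'S_n),
        P [set w | sigma k w = s] = ((n`!)%:R^-1)%:E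
    & forall A : 'I_K -> {set 'S_n},
        P [set w | forall k : 'I_K, sigma k w \in A k] =
          (\prod_(k < K) P [set w | sigma k w \in A k])%E].

Definition Gstar (R : realType) (d n : nat) (f : 'I_n -> 'rV[R]_d -> R)
    (xstar : 'rV[R]_d) : R :=
  \big[Num.max/0]_(i < n) enorm (grad (f i) xstar).

Definition Dconst (R : realType) (d n : nat) (f : 'I_n -> 'rV[R]_d -> R)
    (L : R) (xstar y0 : 'rV[R]_d) : R :=
  Num.max (enorm (y0 - xstar)) (Gstar f xstar / (2 * L)).

Definition Gconst (R : realType) (d n : nat) (f : 'I_n -> 'rV[R]_d -> R)
    (L : R) (xstar y0 : 'rV[R]_d) : R :=
  Gstar f xstar + 2 * L * Dconst f L xstar y0.

(* Main.v *)
Require Import Defs.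
From HB Require Import structures.
From mathcomp Require Import all_boot all_order all_fingroup all_algebra.
From mathcomp Require Import all_classical all_reals all_analysis.
From mathcomp Require Import ring lra.
Set Implicit Arguments.
Unset Strict Implicit.
Unset Printing Implicit Defensive.
Import Order.TTheory GRing.Theory Num.Theory.
Import numFieldNormedType.Exports.
Local Open Scope classical_set_scope.
Local Open Scope ring_scope.

(* Inside one epoch started at y, compare the iterates x_i with the iterates z_i
   of gradient descent on F with the same stepsize eta, and put e_i = x_i - z_i.
   Sampling without replacement gives E|e_i|^2 = O(i eta^2 G^2), and at the end
   of the epoch the leading noise cancels, because each component is used
   exactly once, so that E|e_n|^2 = O(n^3 eta^4 L^2 G^2).  The mean E e_i is
   smaller than the typical e_i: exchanging the component used at step i with a
   uniformly chosen one shows that the sampled gradient has bias O(eta L G) with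
   respect to the gradient of F, while the Lipschitz Hessian of F turns
   E[grad F(x_i)] - grad F(z_i) into H E e_i up to rho E|e_i|^2 / 2.  Hence
   |E e_n| = O(n eta (eta L G + rho n eta^2 G^2)), and the cross term
   2 <z_n - x*, E e_n> is absorbed by the strong convexity of F.  All iterates
   stay in the ball of radius 2 D around x*, which bounds the gradients by G. *)

(** * Euclidean inner product *)

Section Euclid.
Variables (R : realType) (d : nat).
Implicit Types (x y z : 'rV[R]_d) (a b : R).

Definition dot x y : R := \sum_(j < d) x ord0 j * y ord0 j.

Lemma dotC x y : dot x y = dot y x.
Proof. by apply: eq_bigr => j _; rewrite mulrC. Qed.

Lemma dotDl x y z : dot (x + y) z = dot x z + dot y z.
Proof. by rewrite -big_split; apply: eq_bigr => j _; rewrite mxE mulrDl. Qed.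

Lemma dotZl a x y : dot (a *: x) y = a * dot x y.
Proof. by rewrite mulr_sumr; apply: eq_bigr => j _; rewrite mxE mulrA. Qed.

Lemma dotDr x y z : dot x (y + z) = dot x y + dot x z.
Proof. by rewrite dotC dotDl !(dotC _ x). Qed.

Lemma dotZr a x y : dot x (a *: y) = a * dot x y.
Proof. by rewrite dotC dotZl dotC. Qed.

Lemma dotNl x y : dot (- x) y = - dot x y.
Proof. by rewrite -scaleN1r dotZl mulN1r. Qed.

Lemma dotNr x y : dot x (- y) = - dot x y.
Proof. by rewrite dotC dotNl dotC. Qed.

Lemma dot0l x : dot 0 x = 0.
Proof. by rewrite -[0](scale0r 0) dotZl mul0r. Qed.

Lemma dot0r x : dot x 0 = 0.
Proof. by rewrite dotC dot0l. Qed.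

Lemma dot_suml (I : Type) (r : seq I) (P : pred I) (F : I -> 'rV[R]_d) y :
  dot (\sum_(i <- r | P i) F i) y = \sum_(i <- r | P i) dot (F i) y.
Proof.
by apply: (big_morph (fun u => dot u y)); [move=> u v; apply: dotDl | apply: dot0l].
Qed.

Lemma dot_sumr (I : Type) (r : seq I) (P : pred I) (F : I -> 'rV[R]_d) x :
  dot x (\sum_(i <- r | P i) F i) = \sum_(i <- r | P i) dot x (F i).
Proof. by rewrite dotC dot_suml; apply: eq_bigr => i _; rewrite dotC. Qed.

Lemma dotxx_ge0 x : 0 <= dot x x.
Proof. by apply: sumr_ge0 => j _; rewrite -expr2 sqr_ge0. Qed.

Lemma enorm_ge0 x : 0 <= enorm x.
Proof. exact: sqrtr_ge0. Qed.

Lemma sqr_enorm x : enorm x ^+ 2 = dot x x.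
Proof.
rewrite /enorm sqr_sqrtr; last by apply: sumr_ge0 => j _; rewrite sqr_ge0.
by apply: eq_bigr => j _; rewrite expr2.
Qed.

Lemma sqr_enormD x y :
  enorm (x + y) ^+ 2 = enorm x ^+ 2 + 2 * dot x y + enorm y ^+ 2.
Proof. by rewrite !sqr_enorm dotDl !dotDr (dotC y x); ring. Qed.

Lemma enorm_eq0 x : enorm x = 0 -> x = 0.
Proof.
move=> x0; apply/rowP => j; rewrite mxE.
have xge0 k : true -> 0 <= x ord0 k * x ord0 k by rewrite -expr2 sqr_ge0.
have xx0 : dot x x = 0 by rewrite -sqr_enorm x0 expr0n.
by apply/eqP; rewrite -sqrf_eq0 expr2 (psumr_eq0P xge0 xx0).
Qed.

Lemma enormZ a x : enorm (a *: x) = `|a| * enorm x.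
Proof.
apply/eqP; rewrite -(eqrXn2 (n := 2)) ?enorm_ge0 ?mulr_ge0 ?enorm_ge0//.
by rewrite exprMn !sqr_enorm dotZl dotZr mulrA -expr2 real_normK// num_real.
Qed.

Lemma enormN x : enorm (- x) = enorm x.
Proof. by rewrite -scaleN1r enormZ normrN1 mul1r. Qed.

Lemma enorm0 : enorm (0 : 'rV[R]_d) = 0.
Proof. by rewrite -(scale0r 0) enormZ normr0 mul0r. Qed.

Lemma enorm_distC x y : enorm (x - y) = enorm (y - x).
Proof. by rewrite -opprB enormN. Qed.

Lemma dot_le_enorm x y : dot x y <= enorm x * enorm y.
Proof.
have [y0|y0] := eqVneq (enorm y) 0.
  by rewrite (enorm_eq0 y0) dot0r enorm0 mulr0.
apply: le_trans (ler_norm _) _.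
rewrite -(@ler_pXn2r _ 2) ?nnegrE ?mulr_ge0 ?enorm_ge0// real_normK ?num_real//.
have yp : 0 < dot y y by rewrite -sqr_enorm exprn_gt0// lt_def y0 enorm_ge0.
have := dotxx_ge0 (dot y y *: x - dot x y *: y).
rewrite dotDl dotNl !dotDr !dotNr !dotZl !dotZr (dotC y x) exprMn !sqr_enorm => H.
rewrite -(ler_pM2l yp); lra.
Qed.

Lemma norm_dot_le x y : `|dot x y| <= enorm x * enorm y.
Proof.
by rewrite ler_norml dot_le_enorm andbT lerNl -dotNl -(enormN x) dot_le_enorm.
Qed.

Lemma ler_enormD x y : enorm (x + y) <= enorm x + enorm y.
Proof.
rewrite -(@ler_pXn2r _ 2) ?nnegrE ?addr_ge0 ?enorm_ge0//.
by rewrite sqr_enormD sqrrD; have := dot_le_enorm x y; lra.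
Qed.

Lemma ler_enormB x y : enorm (x - y) <= enorm x + enorm y.
Proof. by rewrite -(enormN y) ler_enormD. Qed.

Lemma ler_enorm_sum (I : Type) (r : seq I) (P : pred I) (F : I -> 'rV[R]_d) :
  enorm (\sum_(i <- r | P i) F i) <= \sum_(i <- r | P i) enorm (F i).
Proof.
elim/big_ind2 : _ => [|u a v b ua vb|//]; first by rewrite enorm0.
by apply: le_trans (ler_enormD _ _) _; exact: lerD.
Qed.

(** Testing against [y = x] suffices. It lets [grad_taylor] work with functions of one real
    variable. *)
Lemma enorm_le_of_dot x c : 0 <= c ->
  (forall y, dot x y <= c * enorm y) -> enorm x <= c.
Proof.
move=> c0 /(_ x); rewrite -sqr_enorm expr2.
have [->//|x0] := eqVneq (enorm x) 0.
by rewrite ler_pM2r// lt_def x0 enorm_ge0.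
Qed.

Lemma sqr_sum_le (F : nat -> R) (i : nat) :
  (\sum_(0 <= j < i) F j) ^+ 2 <= i%:R * \sum_(0 <= j < i) F j ^+ 2.
Proof.
elim: i => [|i IH]; first by rewrite !big_geq// expr0n mul0r.
rewrite !big_nat_recr//= -natr1.
set S := \sum_(0 <= j < i) F j in IH *.
set Q := \sum_(0 <= j < i) F j ^+ 2 in IH *.
have [i0|i0] := eqVneq i 0%N.
  by rewrite /S /Q i0 !big_geq// !add0r mul1r.
have ip : 0 < i%:R :> R by rewrite ltr0n lt0n.
have : S * F i * 2 <= Q + i%:R * F i ^+ 2.
  have := sqr_ge0 (S - i%:R * F i) => H; rewrite -(ler_pM2l ip); nra.
nra.
Qed.

End Euclid.

(** * Uniform permutations *)

Section Permutations.
Variables (R : realType) (d n : nat).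
Hypothesis n_gt1 : (1 < n)%N.

Lemma sum_perm_mull (M : nmodType) (t : 'S_n) (X : 'S_n -> M) :
  \sum_p X p = \sum_p X (t * p)%g.
Proof. exact: (reindex_inj (mulgI t)). Qed.

(** Composing with the transposition of [k] and [l] fixes position [j], so the joint law of the
    components at positions [j] and [l] is the same for every [l != j]. *)
Lemma sum_dot_indep (a b : 'I_n -> 'rV[R]_d) (j k l : 'I_n) :
  k != j -> l != j ->
  \sum_(p : 'S_n) dot (a (p j)) (b (p l)) =
  \sum_(p : 'S_n) dot (a (p j)) (b (p k)).
Proof.
move=> kj lj; rewrite (sum_perm_mull (tperm k l)); apply: eq_bigr => p _.
by rewrite !permM tpermR tpermD.
Qed.

(** Over all positions [l] the vectors [b (p l)] cancel, and the [n - 1] off-diagonal terms are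
    equal, so each carries the covariance factor -1/(n-1) of sampling without replacement. *)
Lemma sum_dot_replace (a b : 'I_n -> 'rV[R]_d) (j k : 'I_n) :
  \sum_c b c = 0 -> k != j ->
  (n.-1)%:R * \sum_(p : 'S_n) dot (a (p j)) (b (p k)) =
  - \sum_(p : 'S_n) dot (a (p j)) (b (p j)).
Proof.
move=> b0 kj; apply/eqP; rewrite -addr_eq0 addrC; apply/eqP.
transitivity (\sum_(p : 'S_n) dot (a (p j)) (\sum_(l < n) b (p l))).
  under [RHS]eq_bigr do rewrite dot_sumr.
  rewrite [RHS]exchange_big; rewrite [RHS](bigD1 j)//=; congr (_ + _).
  rewrite [RHS](eq_bigr (fun=> \sum_(p : 'S_n) dot (a (p j)) (b (p k)))); last first.
    by move=> l lj; exact: sum_dot_indep.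
  rewrite sumr_const mulr_natl; congr (_ *+ _).
  by rewrite (cardC1 j) card_ord.
rewrite big1// => p _; rewrite (_ : \sum_(l < n) b (p l) = 0) ?dot0r//.
by rewrite -[RHS]b0 [RHS](reindex_inj (@perm_inj _ p)).
Qed.

(** The summands depend on the position, so cross terms may have either sign. Each carries a factor
    1/(n-1) and a position has at most [n - 1] partners, so together they cost no more than the
    diagonal: hence the factor 2. *)
Lemma sum_sqr_enorm_sampling (a : 'I_n -> 'I_n -> 'rV[R]_d) (J : {set 'I_n}) :
  (forall j, \sum_c a j c = 0) ->
  \sum_(p : 'S_n) enorm (\sum_(j in J) a j (p j)) ^+ 2 <=
  2 * \sum_(j in J) \sum_(p : 'S_n) enorm (a j (p j)) ^+ 2.
Proof.
move=> a0.
have n1 : 0 < (n.-1)%:R :> R by rewrite ltr0n; case: (n) n_gt1 => [|[]].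
pose q j := \sum_(p : 'S_n) enorm (a j (p j)) ^+ 2.
have q_swap j k : \sum_(p : 'S_n) enorm (a k (p j)) ^+ 2 = q k.
  rewrite /q [RHS](sum_perm_mull (tperm j k)); apply: eq_bigr => p _.
  by rewrite permM tpermR.
(* [sum_dot_replace] moves both vectors to position [j]; then |u + v|^2 >= 0 bounds -<u, v>. *)
have cross j k : k != j ->
    \sum_(p : 'S_n) dot (a j (p j)) (a k (p k)) <= (n.-1)%:R^-1 * (q j / 2 + q k / 2).
  move=> kj; rewrite -ler_pdivrMl ?invr_gt0// invrK sum_dot_replace//.
  rewrite -sumrN -(q_swap j k) /q !mulr_suml -big_split /=.
  apply: ler_sum => p _.
  by have := sqr_ge0 (enorm (a j (p j) + a k (p j))); rewrite sqr_enormD; lra.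
have card_others (A : {set 'I_n}) (j : 'I_n) :
    (#|[pred k | (k \in A) && (k != j)]| <= n.-1)%N.
  rewrite -[n in n.-1]card_ord -(cardC1 j) subset_leq_card//.
  by apply/fintype.subsetP => k; rewrite !inE => /andP[].
have q0 j : 0 <= q j by apply: sumr_ge0 => p _; rewrite sqr_ge0.
have sumE : \sum_(p : 'S_n) enorm (\sum_(j in J) a j (p j)) ^+ 2 =
    \sum_(j in J) \sum_(k in J) \sum_(p : 'S_n) dot (a j (p j)) (a k (p k)).
  under eq_bigr => p _.
    rewrite sqr_enorm dot_suml; under eq_bigr do rewrite dot_sumr; over.
  by rewrite exchange_big; apply: eq_bigr => j _; rewrite exchange_big.
rewrite sumE.
apply: (@le_trans _ _ (\sum_(j in J) (q j + \sum_(k in J | k != j)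
    (n.-1)%:R^-1 * (q j / 2 + q k / 2)))).
  apply: ler_sum => j jJ; rewrite (bigD1 j)//= lerD//.
    by apply: ler_sum => p _; rewrite sqr_enorm.
  by apply: ler_sum => k /andP[_ kj]; exact: cross.
apply: (@le_trans _ _ (\sum_(j in J) (q j + (q j / 2 + (n.-1)%:R^-1 *
    \sum_(k in J | k != j) (q k / 2))))).
  apply: ler_sum => j jJ; rewrite lerD2l -mulr_sumr big_split/= mulrDr lerD2r.
  rewrite ler_pdivrMl// sumr_const -[leLHS]mulr_natl ler_wpM2r ?divr_ge0// ler_nat.
  exact: card_others.
rewrite big_split /= big_split /=.
rewrite -mulr_sumr.
have : (n.-1)%:R^-1 * \sum_(j in J) \sum_(k in J | k != j) q k / 2 <=
    \sum_(j in J) q j / 2.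
  rewrite ler_pdivrMl//.
  rewrite (exchange_big_dep (mem J))/=; last by move=> ? ? _ /andP[].
  rewrite mulr_sumr; apply: ler_sum => k kJ.
  rewrite sumr_const -[leLHS]mulr_natl ler_wpM2r ?divr_ge0// ler_nat.
  apply: leq_trans (card_others J k); rewrite subset_leq_card//.
  by apply/fintype.subsetP => l; rewrite !inE => /and3P[-> _ kl]; rewrite eq_sym.
rewrite -mulr_suml -/q.
set A := \sum_(_ in _) \sum_(_ in _ | _) _; set B := \sum_(j in J) q j.
lra.
Qed.

End Permutations.

(** * Averages over finite families *)

Section FiniteSums.
Variables (R : realType) (d : nat).

Lemma ler_sum_card (I : finType) (F : I -> R) (c : R) :
  (forall i, F i <= c) -> \sum_i F i <= #|I|%:R * c.
Proof. by move=> Fc; rewrite mulr_natl -sumr_const; apply: ler_sum. Qed.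

Lemma ler_sum_ord (k : nat) (F : 'I_k -> R) (c : R) :
  (forall i, F i <= c) -> \sum_(i < k) F i <= k%:R * c.
Proof. by move/ler_sum_card; rewrite card_ord. Qed.

(** Variance is at most second moment: [c] is the mean of [X]. *)
Lemma sum_sqr_enormB_mean (I : finType) (X : I -> 'rV[R]_d) (c : 'rV[R]_d) :
  \sum_i X i = #|I|%:R *: c ->
  \sum_i enorm (X i - c) ^+ 2 <= \sum_i enorm (X i) ^+ 2.
Proof.
move=> Xc; under eq_bigr do rewrite sqr_enormD enormN dotNr mulrN -addrA.
rewrite big_split/= gerDl big_split/= sumrN -mulr_sumr -dot_suml Xc dotZl.
rewrite -sqr_enorm sumr_const -[X in _ + X]mulr_natl.
have : 0 <= #|I|%:R * enorm c ^+ 2 by rewrite mulr_ge0 ?sqr_ge0.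
lra.
Qed.

(** The component at a fixed position is uniformly distributed. Multiples on both sides avoid a
    division in [M]. *)
Lemma sum_perm_eval (M : nmodType) (n : nat) (h : 'I_n -> M) (j : 'I_n) :
  (\sum_(p : 'S_n) h (p j)) *+ n = (\sum_c h c) *+ #|{: 'S_n}|.
Proof.
transitivity (\sum_(k < n) \sum_(p : 'S_n) h (p k)).
  rewrite [RHS](eq_bigr (fun=> \sum_(p : 'S_n) h (p j))) ?sumr_const ?card_ord//.
  move=> k _; rewrite (sum_perm_mull (tperm k j)); apply: eq_bigr => p _.
  by rewrite permM tpermL.
rewrite exchange_big -sumr_const; apply: eq_bigr => p _.
by rewrite [RHS](reindex_inj (@perm_inj _ p)).
Qed.

Lemma sum_nat_ord (M : nmodType) (m i : nat) (F : 'I_m.+1 -> M) :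
  (i <= m.+1)%N ->
  \sum_(0 <= j < i) F (inord j) = \sum_(j in [set j : 'I_m.+1 | (j < i)%N]%SET) F j.
Proof.
move=> im; rewrite big_mkord (big_ord_widen _ (fun j => F (inord j)) im).
by apply: eq_big => j; rewrite ?inE// inord_val.
Qed.

End FiniteSums.

(** Closing arithmetic of [sum_sqr_err]: [a] counts permutations, [e], [l], [q], [x] are [eta], [L],
    [G], [i], and [A], [B] are the earlier squared errors and the squared noise. *)
Fact sum_sqr_err_arith (R : realFieldType) (A B a e l q x : R) :
  a * e ^+ 2 * q ^+ 2 * x * ((e * l) ^+ 2 * x ^+ 2) <=
    a * e ^+ 2 * q ^+ 2 * x * (1 / 32) ^+ 2 ->
  (1 + 16^-1) * e ^+ 2 * B <= (1 + 16^-1) * e ^+ 2 * (a * (2 * x * q ^+ 2)) ->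
  (1 + 16) * ((e * l) ^+ 2 * x) * A <=
    (1 + 16) * ((e * l) ^+ 2 * x) * (a * (9 / 4 * e ^+ 2 * q ^+ 2) * (x ^+ 2 / 2)) ->
  0 <= a * e ^+ 2 * q ^+ 2 * x ->
  (1 + 16) * ((e * l) ^+ 2 * (x * A)) + (1 + 16^-1) * (e ^+ 2 * B) <=
    9 / 4 * (a * e ^+ 2 * q ^+ 2 * x).
Proof. lra. Qed.

(** Induction step of [mean_err], with [q] the growth factor and [b] the sampling bias. The Taylor
    term contributes 9/8 x <= 9/16 ((x+1)^2 - x^2), which gives the 9/16. *)
Fact mean_err_arith (R : realFieldType) (E N q e L x b rho G : R) :
  0 <= e -> 0 <= L -> 0 <= N -> 0 <= x -> 0 <= b -> 0 <= rho ->
  1 <= (1 + e * L) * q ->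
  E <= N * (q * (e * (x * b + 9 / 16 * rho * x ^+ 2 * e ^+ 2 * G ^+ 2))) ->
  E + e * (L * E) + e * (N * b) + e * (rho / 2 * (N * (9 / 4 * x * e ^+ 2 * G ^+ 2))) <=
  N * ((1 + e * L) * q *
    (e * ((x + 1) * b + 9 / 16 * rho * (x + 1) ^+ 2 * e ^+ 2 * G ^+ 2))).
Proof.
move=> e0 L0 N0 x0 b0 rho0 q1 le1.
have a0 : 0 <= 1 + e * L by rewrite addr_ge0// mulr_ge0.
have c0 : 0 <= rho * e ^+ 2 * G ^+ 2 by do 2![rewrite mulr_ge0 ?sqr_ge0//].
have r0 : 0 <= N * (e * (b + 9 / 16 * (rho * e ^+ 2 * G ^+ 2) * (2 * x + 1))).
  by rewrite mulr_ge0// mulr_ge0// addr_ge0// mulr_ge0//; lra.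
have h1 := ler_wpM2l a0 le1.
have h2 := ler_wpM2r r0 q1.
have h3 : 0 <= N * (e * (rho * e ^+ 2 * G ^+ 2)) by rewrite mulr_ge0// mulr_ge0.
lra.
Qed.

(** * Sampled iterates against gradient descent inside an epoch *)

Section Epoch.
Variables (R : realType) (d m : nat).
Local Notation n := m.+2.
Local Notation V := 'rV[R]_d.
Local Notation N := (#|{: 'S_n}|%:R : R).
Variables (g : 'I_n -> V -> V) (L eta : R).

(** Components enter only through vector fields [g c], later their gradients, so this stands for the
    gradient of F. Expectations are kept as sums over ['S_n], compared with multiples of [N]. *)
Definition mean_field (x : V) : V := n%:R^-1 *: \sum_c g c x.

Fixpoint inner (p : 'S_n) (y : V) (i : nat) : V :=
  if i is j.+1 then
    inner p y j - eta *: g (p (inord j)) (inner p y j)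
  else y.

Fixpoint gd (y : V) (i : nat) : V :=
  if i is j.+1 then gd y j - eta *: mean_field (gd y j) else y.

Hypothesis L_ge0 : 0 <= L.
Hypothesis eta_gt0 : 0 < eta.
Hypothesis g_lip : forall c x y, enorm (g c x - g c y) <= L * enorm (x - y).
Hypothesis step_le : n%:R * eta * L <= 1 / 32.

Lemma mean_field_lip x y :
  enorm (mean_field x - mean_field y) <= L * enorm (x - y).
Proof.
rewrite -scalerBr enormZ ger0_norm ?invr_ge0// ler_pdivrMl ?ltr0n//.
rewrite -sumrB (le_trans (ler_enorm_sum _ _ _))//.
rewrite (le_trans (ler_sum _ (fun c _ => g_lip c x y)))//.
by rewrite sumr_const card_ord mulr_natl.
Qed.

(** With a = eta L, (1 + a)^i (1 - a)^i <= 1, and Bernoulli's inequality gives (1 - a)^i >= 1 - i a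
    >= 31/32. *)
Lemma growth_le i : (i <= n)%N -> (1 + eta * L) ^+ i <= 32 / 31.
Proof.
move=> iln.
have a0 : 0 <= eta * L by rewrite mulr_ge0// ltW.
have ia : i%:R * (eta * L) <= 1 / 32.
  by apply: le_trans step_le; rewrite -mulrA ler_wpM2r// ler_nat.
have a1 : eta * L <= 1 / 32.
  apply: le_trans step_le; rewrite -mulrA -[leLHS]mul1r ler_wpM2r//.
  by rewrite (ler_nat _ 1).
have bern k : 1 - k%:R * (eta * L) <= (1 - eta * L) ^+ k.
  elim: k => [|k IH]; first by rewrite mul0r subr0 expr0.
  rewrite exprS -natr1.
  have k0 : 0 <= k%:R :> R by [].
  apply: (@le_trans _ _ ((1 - eta * L) * (1 - k%:R * (eta * L)))).
    by have := mulr_ge0 k0 (sqr_ge0 (eta * L)); nra.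
  by rewrite ler_wpM2l//; lra.
have q0 : 0 <= (1 + eta * L) ^+ i by rewrite exprn_ge0//; lra.
have : (1 + eta * L) ^+ i * (1 - eta * L) ^+ i <= 1.
  by rewrite -exprMn -[leRHS](expr1n _ i) lerXn2r ?nnegrE; nra.
have := bern i; nra.
Qed.

Section FromStart.
Variables (y : V) (G W : R).
Hypothesis G_ge0 : 0 <= G.
Hypothesis inner_bound : forall c p i, (i <= n)%N -> enorm (g c (inner p y i)) <= G.
Hypothesis gd_bound : forall c i, (i <= n)%N -> enorm (g c (gd y i)) <= G.
Hypothesis gd_dist : forall i, (i <= n)%N -> enorm (gd y i - y) <= W.

(** Before step [i] the two runs use different components at step [l] only. That step separates them
    by at most 2 eta G, and each later step expands the gap by at most 1 + eta L. *)
Lemma inner_tperm (p : 'S_n) (i l : 'I_n) j : (j <= i)%N ->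
  enorm (inner (tperm i l * p)%g y j - inner p y j) <=
  (l < j)%N%:R * ((1 + eta * L) ^+ j * (2 * eta * G)).
Proof.
have a0 : 0 <= eta * L by rewrite mulr_ge0// ltW.
elim: j => [|j IH] ji; first by rewrite subrr enorm0 ltn0 mul0r.
have {}IH := IH (ltnW ji).
have jn : (j < n)%N by rewrite (ltn_trans ji).
have qj : 1 <= (1 + eta * L) ^+ j.+1 by rewrite exprn_ege1// lerDl.
(* At step [l] itself the iterates still coincide, so only the two sampled gradients differ. *)
have [jl|jl] := eqVneq (inord j) l.
  have lj : l = j :> nat by rewrite -jl inordK.
  have eqj : inner (tperm i l * p)%g y j = inner p y j.
    by move: IH; rewrite lj ltnn mul0r => IH; apply/eqP; rewrite -subr_eq0;
       apply/eqP/enorm_eq0/le_anti; rewrite IH enorm_ge0.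
  rewrite lj leqnn mul1r /= eqj opprD opprK addrACA subrr add0r addrC -scalerBr enormZ.
  rewrite gtr0_norm//.
  have := ler_enormB (g (p (inord j)) (inner p y j))
    (g ((tperm i l * p)%g (inord j)) (inner p y j)).
  have := inner_bound (p (inord j)) p (ltnW jn).
  have := inner_bound ((tperm i l * p)%g (inord j)) p (ltnW jn).
  set A := enorm _; set B := enorm _; set C := enorm _ => h1 h2 h3.
  have e0 := ltW eta_gt0.
  apply: (@le_trans _ _ (2 * eta * G)).
    have := ler_wpM2l e0 h3; have := ler_wpM2l e0 h2; have := ler_wpM2l e0 h1.
    lra.
  by rewrite ler_peMl// !mulr_ge0// ltW.
have pj : (tperm i l * p)%g (inord j) = p (inord j).
  rewrite permM tpermD//; last by rewrite eq_sym.
  by apply: contraTneq ji => ->; rewrite inordK// ltnn.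
rewrite /= pj opprD addrACA -opprB -opprD -scalerBr.
rewrite -[X in - X + _]opprB opprK.
apply: le_trans (ler_enormB _ _) _; rewrite enormZ gtr0_norm//.
have := g_lip (p (inord j)) (inner (tperm i l * p)%g y j) (inner p y j).
have -> : (l < j.+1)%N = (l < j)%N.
  rewrite ltnS leq_eqVlt; case: eqP => //= lj.
  by move: jl; rewrite -lj inord_val eqxx.
rewrite exprS.
move: IH; set q := _ * (_ ^+ j * _); set A := enorm _ => IH; set B := enorm _ => AB.
have -> : (l < j)%N%:R * ((1 + eta * L) * (1 + eta * L) ^+ j * (2 * eta * G)) =
  (1 + eta * L) * q by rewrite /q; ring.
have := ler_wpM2l (ltW eta_gt0) AB; nra.
Qed.

(* Exchanging the component used at step i with a uniformly chosen one turns the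
   sampled gradient into the mean field, at the cost of moving the iterate. *)
Lemma sampling_bias (i : 'I_n) :
  enorm (\sum_(p : 'S_n) (g (p i) (inner p y i) - mean_field (inner p y i))) <=
  N * (L * (64 / 31 * eta * G)).
Proof.
have swap l : \sum_(p : 'S_n) g (p i) (inner p y i) =
    \sum_(p : 'S_n) g (p l) (inner (tperm i l * p)%g y i).
  by rewrite (sum_perm_mull (tperm i l)); apply: eq_bigr => p _; rewrite permM tpermL.
have -> : \sum_(p : 'S_n) (g (p i) (inner p y i) - mean_field (inner p y i)) =
    n%:R^-1 *: \sum_(l < n) \sum_(p : 'S_n)
      (g (p l) (inner (tperm i l * p)%g y i) - g (p l) (inner p y i)).
  under [in RHS]eq_bigr do rewrite sumrB -swap.
  rewrite !sumrB sumr_const card_ord -[X in _ *: (X - _)]scaler_nat scalerBr scalerA.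
  rewrite mulVf ?pnatr_eq0// scale1r; congr (_ - _).
  rewrite exchange_big scaler_sumr; apply: eq_bigr => p _; congr (_ *: _).
  by rewrite [LHS](reindex_inj (@perm_inj _ p)).
rewrite enormZ ger0_norm ?invr_ge0// ler_pdivrMl ?ltr0n//.
apply: le_trans (ler_enorm_sum _ _ _) _.
apply: ler_sum_ord => l.
apply: le_trans (ler_enorm_sum _ _ _) _.
apply: ler_sum_card => p.
apply: le_trans (g_lip _ _ _) _; rewrite ler_wpM2l//.
apply: le_trans (inner_tperm _ _ (leqnn i)) _.
(* The 64/31 is twice the 32/31 of [growth_le]. *)
have := growth_le (ltnW (ltn_ord i)) => q.
have G2 : 0 <= 2 * eta * G by rewrite !mulr_ge0// ltW.
have q0 : 0 <= (1 + eta * L) ^+ i.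
  by rewrite exprn_ge0// addr_ge0// mulr_ge0// ltW.
case: (l < i)%N; rewrite ?mul1r ?mul0r; last by nra.
by have := ler_wpM2r G2 q; lra.
Qed.

Local Notation err p i := (inner p y i - gd y i).
Local Notation noise p i :=
  (\sum_(0 <= j < i) (g (p (inord j)) (gd y j) - mean_field (gd y j))).

Lemma err_recE (p : 'S_n) i :
  err p i.+1 = err p i -
    eta *: (g (p (inord i)) (inner p y i) - mean_field (gd y i)).
Proof. by apply/rowP => k; rewrite /= !mxE; ring. Qed.

(** The noise is evaluated along [gd y], which does not depend on [p], so the sampling lemma applies
    to it; the rest is controlled by earlier errors. *)
Lemma err_sumE (p : 'S_n) i :
  err p i = - (eta *: (\sum_(0 <= j < i)
    (g (p (inord j)) (inner p y j) - g (p (inord j)) (gd y j)) + noise p i)).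
Proof.
elim: i => [|i IH]; first by rewrite !big_geq// subrr addr0 scaler0 oppr0.
rewrite err_recE IH !big_nat_recr//= addrACA subrKA [in RHS]scalerDr opprD.
by [].
Qed.

(** Young's inequality with free weight [t], then Cauchy-Schwarz on the sum of errors. A large [t]
    keeps the noise coefficient near 1. *)
Lemma sqr_err_le (t : R) (p : 'S_n) i : 0 < t ->
  enorm (err p i) ^+ 2 <=
    (1 + t) * ((eta * L) ^+ 2 * (i%:R * \sum_(0 <= j < i) enorm (err p j) ^+ 2)) +
    (1 + t^-1) * (eta ^+ 2 * enorm (noise p i) ^+ 2).
Proof.
move=> t0.
set A := \sum_(0 <= j < i) enorm (err p j); set B := enorm (noise p i).
have A0 : 0 <= A by apply: sumr_ge0 => j _; exact: enorm_ge0.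
have B0 : 0 <= B by exact: enorm_ge0.
have e0 := ltW eta_gt0.
have le1 : enorm (err p i) <= eta * L * A + eta * B.
  rewrite err_sumE enormN enormZ gtr0_norm// -mulrA -mulrDr ler_wpM2l//.
  apply: le_trans (ler_enormD _ _) _; rewrite lerD2r.
  apply: le_trans (ler_enorm_sum _ _ _) _; rewrite mulr_sumr.
  by apply: ler_sum => j _; exact: g_lip.
have le2 : enorm (err p i) ^+ 2 <= (eta * L * A + eta * B) ^+ 2.
  by rewrite lerXn2r// nnegrE ?enorm_ge0// addr_ge0// !mulr_ge0.
apply: (le_trans le2).
apply: (@le_trans _ _ ((1 + t) * ((eta * L) ^+ 2 * A ^+ 2) +
    (1 + t^-1) * (eta ^+ 2 * B ^+ 2))).
  have : 0 <= t^-1 * (t * (eta * L * A) - eta * B) ^+ 2.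
    by rewrite mulr_ge0 ?sqr_ge0// invr_ge0 ltW.
  have -> : t^-1 * (t * (eta * L * A) - eta * B) ^+ 2 =
      t * (eta * L * A) ^+ 2 - 2 * (eta * L * A) * (eta * B) + t^-1 * (eta * B) ^+ 2.
    by field; rewrite gt_eqF.
  lra.
have t1 : 0 <= 1 + t by rewrite addr_ge0// ltW.
by rewrite lerD2r ler_wpM2l// ler_wpM2l ?sqr_ge0// sqr_sum_le.
Qed.

Lemma sum_perm_mean_field (x : V) (j : 'I_n) :
  \sum_(p : 'S_n) g (p j) x = N *: mean_field x.
Proof.
have := sum_perm_eval (fun c => g c x) j => /= /(congr1 (fun v => n%:R^-1 *: v)).
rewrite -[X in _ *: X = _]scaler_nat -[X in _ = _ *: X]scaler_nat !scalerA.
rewrite mulVf ?pnatr_eq0// scale1r => ->.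
by rewrite mulrC -scalerA.
Qed.

Lemma mean_field_sum (x : V) : \sum_c (g c x - mean_field x) = 0.
Proof.
rewrite sumrB sumr_const card_ord -scaler_nat scalerA divff ?pnatr_eq0//.
by rewrite scale1r subrr.
Qed.

Lemma sum_sqr_noise i : (i <= n)%N ->
  \sum_(p : 'S_n) enorm (noise p i) ^+ 2 <= N * (2 * i%:R * G ^+ 2).
Proof.
move=> iln.
pose a (j c : 'I_n) := g c (gd y j) - mean_field (gd y j).
have noiseE (p : 'S_n) :
    noise p i = \sum_(j in [set j : 'I_n | (j < i)%N]%SET) a j (p j).
  rewrite -(sum_nat_ord (fun j => a j (p j)) iln); apply: eq_big_nat => j /andP[_ ji].
  by rewrite /a inordK// (leq_trans ji).
under eq_bigr do rewrite noiseE.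
apply: le_trans (sum_sqr_enorm_sampling _ _ _) _ => //.
  by move=> j; exact: mean_field_sum.
rewrite (_ : N * _ = 2 * (i%:R * (N * G ^+ 2))); last by ring.
rewrite ler_wpM2l//.
have -> : i%:R * (N * G ^+ 2) = \sum_(j in [set j : 'I_n | (j < i)%N]%SET) N * G ^+ 2.
  rewrite -(sum_nat_ord (fun j => N * G ^+ 2) iln).
  by rewrite sumr_const_nat subn0 mulr_natl.
apply: ler_sum => j _.
apply: (@le_trans _ _ (\sum_(p : 'S_n) enorm (g (p j) (gd y j)) ^+ 2)).
  by apply: sum_sqr_enormB_mean; exact: sum_perm_mean_field.
apply: ler_sum_card => p; rewrite lerXn2r ?nnegrE ?enorm_ge0//.
by apply: gd_bound; exact: ltnW.
Qed.

Lemma sum_nat_le i : \sum_(0 <= j < i) j%:R <= i%:R ^+ 2 / 2 :> R.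
Proof.
elim: i => [|i IH]; first by rewrite big_geq// expr0n mul0r.
by rewrite big_nat_recr//= -natr1; lra.
Qed.

Lemma step_sq_le i : (i <= n)%N -> (eta * L) ^+ 2 * i%:R ^+ 2 <= (1 / 32) ^+ 2.
Proof.
move=> iln; have e0 := ltW eta_gt0.
have q0 : 0 <= i%:R * eta * L by rewrite !mulr_ge0.
have q1 : i%:R * eta * L <= 1 / 32.
  by apply: le_trans step_le; rewrite !ler_wpM2r// ler_nat.
rewrite (_ : _ * _ = (i%:R * eta * L) ^+ 2); last by ring.
nra.
Qed.

(* With weight 16 in [sqr_err_le], 9/4 absorbs 2 * (1 + 1/16) + 17 * (9/8) / 32^2. *)
Lemma sum_sqr_err i : (i <= n)%N ->
  \sum_(p : 'S_n) enorm (err p i) ^+ 2 <= N * (9 / 4 * i%:R * eta ^+ 2 * G ^+ 2).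
Proof.
elim/ltn_ind: i => i IH iln.
have h16 : (0 : R) < 16 by [].
have e0 := ltW eta_gt0.
apply: le_trans (ler_sum _ (fun p _ => sqr_err_le p i h16)) _.
rewrite big_split/= -!mulr_sumr exchange_big/=.
have le1 : \sum_(0 <= j < i) \sum_(p : 'S_n) enorm (err p j) ^+ 2 <=
    N * (9 / 4 * eta ^+ 2 * G ^+ 2) * (i%:R ^+ 2 / 2).
  apply: (@le_trans _ _ (\sum_(0 <= j < i) N * (9 / 4 * eta ^+ 2 * G ^+ 2) * j%:R)).
    rewrite !big_nat; apply: ler_sum => j /andP[_ ji].
    by apply: le_trans (IH j ji (ltnW (leq_trans ji iln))) _; lra.
  by rewrite -mulr_sumr ler_wpM2l ?sum_nat_le// !mulr_ge0 ?invr_ge0 ?sqr_ge0//.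
have le2 := sum_sqr_noise iln.
have le3 := step_sq_le iln.
have c0 : 0 <= (1 + 16) * ((eta * L) ^+ 2 * i%:R) by rewrite !mulr_ge0 ?sqr_ge0.
have := ler_wpM2l c0 le1.
have e2 : 0 <= (1 + 16^-1) * eta ^+ 2 by rewrite mulr_ge0 ?sqr_ge0//; lra.
have := ler_wpM2l e2 le2.
set A := \sum_(0 <= j < i) _; set B := \sum_p _.
have X0 : 0 <= N * eta ^+ 2 * G ^+ 2 * i%:R by rewrite !mulr_ge0 ?sqr_ge0.
have h1 := ler_wpM2l X0 le3.
move=> h2 h3; rewrite (_ : N * (9 / 4 * i%:R * eta ^+ 2 * G ^+ 2) =
  9 / 4 * (N * eta ^+ 2 * G ^+ 2 * i%:R)); last by ring.
exact: sum_sqr_err_arith h1 h2 h3 X0.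
Qed.

(** Over a full epoch the noise at the fixed point [y] sums to zero, so each gradient may be
    recentred at [y]. Noise of size [G] becomes noise of size [L * W]. *)
Lemma sum_sqr_err_end :
  \sum_(p : 'S_n) enorm (err p n) ^+ 2 <=
  N * (9 / 4 * eta ^+ 4 * L ^+ 2 * G ^+ 2 * n%:R ^+ 3
       + 4 * eta ^+ 2 * n%:R * L ^+ 2 * W ^+ 2).
Proof.
have h1 : (0 : R) < 1 by [].
have e0 := ltW eta_gt0.
apply: le_trans (ler_sum _ (fun p _ => sqr_err_le p n h1)) _.
rewrite big_split/= -!mulr_sumr exchange_big/=.
have le1 : \sum_(0 <= j < n) \sum_(p : 'S_n) enorm (err p j) ^+ 2 <=
    N * (9 / 4 * eta ^+ 2 * G ^+ 2) * (n%:R ^+ 2 / 2).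
  apply: (@le_trans _ _ (\sum_(0 <= j < n) N * (9 / 4 * eta ^+ 2 * G ^+ 2) * j%:R)).
    rewrite !big_nat; apply: ler_sum => j /andP[_ ji].
    by apply: le_trans (sum_sqr_err (ltnW ji)) _; lra.
  by rewrite -mulr_sumr ler_wpM2l ?sum_nat_le// !mulr_ge0 ?invr_ge0 ?sqr_ge0//.
have le2 : \sum_(p : 'S_n) enorm (noise p n) ^+ 2 <= N * (2 * n%:R * (L * W) ^+ 2).
  pose a (j c : 'I_n) := g c (gd y j) - mean_field (gd y j) - (g c y - mean_field y).
  have noiseE (p : 'S_n) :
      noise p n = \sum_(j in [set j : 'I_n | (j < n)%N]%SET) a j (p j).
    rewrite (_ : [set j : 'I_n | (j < n)%N]%SET = [set: 'I_n]%SET); last first.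
      by apply/setP => j; rewrite !inE ltn_ord.
    rewrite [RHS](eq_bigl xpredT) => [|j]; last by rewrite inE.
    rewrite big_mkord [RHS]sumrB.
    have -> : \sum_(j < n) (g (p j) y - mean_field y) = 0.
      by rewrite -[RHS](mean_field_sum y) [RHS](reindex_inj (@perm_inj _ p)).
    by rewrite subr0; apply: eq_bigr => j _; rewrite inord_val.
  under eq_bigr do rewrite noiseE.
  apply: le_trans (sum_sqr_enorm_sampling _ _ _) _ => //.
    by move=> j; rewrite sumrB !mean_field_sum subrr.
  rewrite (_ : N * _ = 2 * (n%:R * (N * (L * W) ^+ 2))); last by ring.
  rewrite ler_wpM2l//.
  have -> : n%:R * (N * (L * W) ^+ 2) =
      \sum_(j in [set j : 'I_n | (j < n)%N]%SET) N * (L * W) ^+ 2.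
    rewrite -(sum_nat_ord (fun j => N * (L * W) ^+ 2) (leqnn n)).
    by rewrite sumr_const_nat subn0 mulr_natl.
  apply: ler_sum => j _.
  apply: (@le_trans _ _ (\sum_(p : 'S_n) enorm (g (p j) (gd y j) - g (p j) y) ^+ 2)).
    have aE c : a j c = g c (gd y j) - g c y - (mean_field (gd y j) - mean_field y).
      by apply/rowP => k; rewrite !mxE; ring.
    under eq_bigr do rewrite aE.
    apply: sum_sqr_enormB_mean.
    by rewrite sumrB !sum_perm_mean_field scalerBr.
  apply: ler_sum_card => p; rewrite lerXn2r ?nnegrE ?enorm_ge0//.
    by rewrite mulr_ge0// (le_trans (enorm_ge0 _) (gd_dist (ltn0Sn _))).
  apply: le_trans (g_lip _ _ _) _; rewrite ler_wpM2l//.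
  by apply: gd_dist; exact: ltnW.
have c0 : 0 <= (1 + 1) * ((eta * L) ^+ 2 * n%:R) by rewrite !mulr_ge0 ?sqr_ge0.
have := ler_wpM2l c0 le1.
have e2 : 0 <= (1 + 1^-1) * eta ^+ 2 by rewrite mulr_ge0 ?sqr_ge0//; lra.
have := ler_wpM2l e2 le2.
set A := \sum_(0 <= j < n) _; set B := \sum_p _.
move=> h2 h3; lra.
Qed.

(** The point [gd y i] is common to all permutations, so [H (gd y i)] acts on the summed error. The
    recursion adds only the sampling bias and the Taylor remainder, the latter bounded by
    [sum_sqr_err]. *)
Lemma mean_err (H : V -> 'M[R]_d) (rho : R) : 0 <= rho ->
  (forall x e, enorm (mean_field (x + e) - mean_field x - e *m H x) <=
     rho / 2 * enorm e ^+ 2) ->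
  (forall x e, enorm (e *m H x) <= L * enorm e) ->
  forall i, (i <= n)%N ->
  enorm (\sum_(p : 'S_n) err p i) <=
  N * ((1 + eta * L) ^+ i * (eta * (i%:R * (L * (64 / 31 * eta * G)) +
     9 / 16 * rho * i%:R ^+ 2 * eta ^+ 2 * G ^+ 2))).
Proof.
move=> rho0 taylor Hle; elim=> [|i IH] iln.
  rewrite big1 => [|p _]; last by rewrite subrr.
  by rewrite enorm0 expr0n !(mul0r, mulr0, addr0).
have {IH} := IH (ltnW iln).
set beta := L * _.
have e0 := ltW eta_gt0.
have beta0 : 0 <= beta by rewrite !mulr_ge0.
have -> : \sum_(p : 'S_n) err p i.+1 = \sum_(p : 'S_n) err p i
   - eta *: ((\sum_(p : 'S_n) err p i) *m H (gd y i))
   - eta *: (\sum_(p : 'S_n)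
       (g (p (Ordinal iln)) (inner p y i) - mean_field (inner p y i)))
   - eta *: (\sum_(p : 'S_n) (mean_field (gd y i + err p i) - mean_field (gd y i)
        - err p i *m H (gd y i))).
  rewrite mulmx_suml !scaler_sumr -!sumrN -!big_split; apply: eq_bigr => p _ /=.
  rewrite -/(inner p y i.+1) -/(gd y i.+1) err_recE.
  have -> : inord i = Ordinal iln by apply: val_inj; rewrite /= inordK.
  rewrite [gd y i + _]addrC subrK.
  move: (_ *m _) => e; apply/rowP => k; rewrite !mxE; ring.
set E := \sum_(p : 'S_n) err p i.
have le1 := sampling_bias (Ordinal iln).
have le2 : enorm (\sum_(p : 'S_n) (mean_field (gd y i + err p i) - mean_field (gd y i)
        - err p i *m H (gd y i))) <= rho / 2 * (N * (9 / 4 * i%:R * eta ^+ 2 * G ^+ 2)).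
  apply: le_trans (ler_enorm_sum _ _ _) _.
  apply: (@le_trans _ _ (rho / 2 * \sum_(p : 'S_n) enorm (err p i) ^+ 2)).
    by rewrite mulr_sumr; apply: ler_sum => p _; exact: taylor.
  rewrite ler_wpM2l ?divr_ge0//; exact: sum_sqr_err (ltnW iln).
have le3 := Hle (gd y i) E.
move: le1 le2; rewrite -/beta; set U := \sum_p _; set U' := \sum_p _ => le1 le2 le4.
apply: le_trans (ler_enormB _ _) _; rewrite enormZ gtr0_norm//.
apply: (@le_trans _ _ (enorm E + eta * (L * enorm E) + eta * (N * beta) +
   eta * (rho / 2 * (N * (9 / 4 * i%:R * eta ^+ 2 * G ^+ 2))))).
  apply: lerD; last by rewrite ler_wpM2l.
  apply: le_trans (ler_enormB _ _) _; rewrite enormZ gtr0_norm//.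
  apply: lerD; last by rewrite ler_wpM2l.
  apply: le_trans (ler_enormB _ _) _; rewrite enormZ gtr0_norm//.
  by rewrite lerD2l ler_wpM2l.
have q1 : 1 <= (1 + eta * L) ^+ i.+1 by rewrite exprn_ege1// lerDl mulr_ge0.
by move: q1; rewrite exprS -[i.+1%:R]natr1 => q1; exact: mean_err_arith.
Qed.

End FromStart.
End Epoch.

(** * One epoch *)

(** Turns the [n] contractions of gradient descent into a rate linear in [n], up to a quadratic
    loss. *)
Lemma pow_one_sub_le (R : realFieldType) (a : R) k : 0 <= a <= 1 ->
  (1 - a) ^+ k <= 1 - k%:R * a + (k%:R * a) ^+ 2 / 2.
Proof.
move=> /andP[a0 a1]; elim: k => [|k IH]; first by rewrite expr0 mul0r; lra.
rewrite exprS -[k.+1%:R]natr1.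
have k0 : 0 <= k%:R :> R by [].
have a1' : 0 <= 1 - a by lra.
apply: le_trans (ler_wpM2l a1' IH) _.
have : 0 <= k%:R * k%:R * a ^+ 3 by rewrite !mulr_ge0// exprn_ge0.
have := sqr_ge0 a; lra.
Qed.

(** Here [X] is eta L G and [Y] is rho n eta^2 G^2. The Young weights 5 and 5/4 suffice: 5 (64/31)^2
    (32/31)^2 < 30 and 5/4 (9/16)^2 (32/31)^2 < 1/2. *)
Fact epoch_noise_arith (R : realFieldType) (h mu q S Q X Y : R) :
  0 < h -> 0 < mu -> 0 <= q -> q <= 32 / 31 -> 0 <= X -> 0 <= Y ->
  (q * (h * (64 / 31 * X + 9 / 16 * Y))) ^+ 2 / (h * mu) <=
  h / mu * (30 * X ^+ 2 + 1 / 2 * Y ^+ 2).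
Proof.
move=> h0 mu0 q0 q1 X0 Y0.
have Z0 : 0 <= 64 / 31 * X + 9 / 16 * Y by lra.
have q2 : q ^+ 2 <= (32 / 31) ^+ 2 by rewrite lerXn2r ?nnegrE//; lra.
have Z2 : (64 / 31 * X + 9 / 16 * Y) ^+ 2 <=
    5 * (64 / 31 * X) ^+ 2 + 5 / 4 * (9 / 16 * Y) ^+ 2.
  have := sqr_ge0 (4 * (64 / 31 * X) - 9 / 16 * Y); lra.
have -> : (q * (h * (64 / 31 * X + 9 / 16 * Y))) ^+ 2 / (h * mu) =
  h / mu * (q ^+ 2 * (64 / 31 * X + 9 / 16 * Y) ^+ 2).
  by field; rewrite !gt_eqF.
rewrite ler_pM2l ?divr_gt0//.
have := ler_pM (sqr_ge0 q) (sqr_ge0 _) q2 Z2.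
have := sqr_ge0 X; have := sqr_ge0 Y.
lra.
Qed.

(** Young's inequality weighted so that the cross term consumes about half of the contraction 63/32
    h mu. *)
Fact drift_arith (R : realFieldType) (h mu r m : R) :
  0 < h -> 0 < mu -> 2 * (r * m) <= h * mu * r ^+ 2 + m ^+ 2 / (h * mu).
Proof.
move=> h0 mu0; have hm := mulr_gt0 h0 mu0.
have : 0 <= (h * mu * r - m) ^+ 2 / (h * mu) by rewrite divr_ge0 ?sqr_ge0 ?ltW.
have -> : (h * mu * r - m) ^+ 2 / (h * mu) =
    h * mu * r ^+ 2 - 2 * (r * m) + m ^+ 2 / (h * mu).
  by field; rewrite !gt_eqF.
lra.
Qed.

(* [x] is the number of components, and [A * r ^+ 2], [M], [E2] bound the three
   terms of |z_n - xs + e_n|^2 after averaging, where [r] = |y - xs|. *)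
Fact epoch_bound_arith (R : realFieldType) (x e mu L rho G r A M E2 : R) :
  0 < x -> 0 < e -> 0 < mu -> 0 < L ->
  x * e * L ^+ 2 <= mu / 32 -> x * e * mu <= 1 / 32 -> e * mu <= 1 / 64 ->
  A <= 1 - x * (63 / 32 * (e * mu)) + (x * (63 / 32 * (e * mu))) ^+ 2 / 2 ->
  M <= x * e * mu * r ^+ 2 +
     x * e / mu * (30 * (e * L * G) ^+ 2 + 1 / 2 * (rho * x * e ^+ 2 * G ^+ 2) ^+ 2) ->
  E2 <= 9 / 4 * e ^+ 4 * L ^+ 2 * G ^+ 2 * x ^+ 3
       + 4 * e ^+ 2 * x * L ^+ 2 * (x * e * L * r) ^+ 2 ->
  A * r ^+ 2 + M + E2 <=
  (1 - 3 / 4 * (x * e * mu)) * r ^+ 2 + 3 / 4 * (x * e * mu) *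
    (64 * L ^+ 2 * G ^+ 2 / mu ^+ 2 * e ^+ 2
     + 6 * L ^+ 2 * G ^+ 2 / mu * x ^+ 2 * e ^+ 3
     + 8 * rho ^+ 2 * G ^+ 4 / (9 * mu ^+ 2) * x ^+ 2 * e ^+ 4).
Proof.
move=> x0 e0 mu0 L0 hL epoch_rate_le emu hA hM hE.
have h0 : 0 < x * e by rewrite mulr_gt0.
have r2 := sqr_ge0 r.
(* Multiplying by the rate 3/4 x e mu turns 64, 6, 8/9 into 48, 9/2, 2/3, which dominate the
   required 30, 9/4, 1/2. *)
have -> : 3 / 4 * (x * e * mu) *
    (64 * L ^+ 2 * G ^+ 2 / mu ^+ 2 * e ^+ 2
     + 6 * L ^+ 2 * G ^+ 2 / mu * x ^+ 2 * e ^+ 3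
     + 8 * rho ^+ 2 * G ^+ 4 / (9 * mu ^+ 2) * x ^+ 2 * e ^+ 4) =
  x * e / mu * (48 * (e * L * G) ^+ 2 + 2 / 3 * (rho * x * e ^+ 2 * G ^+ 2) ^+ 2)
  + 9 / 2 * (e ^+ 4 * L ^+ 2 * G ^+ 2 * x ^+ 3).
  by field; rewrite gt_eqF.
have t1 : 0 <= x * e / mu by rewrite divr_ge0 ?ltW.
have t2 : x * e / mu * (30 * (e * L * G) ^+ 2 + 1 / 2 * (rho * x * e ^+ 2 * G ^+ 2) ^+ 2)
  <= x * e / mu * (48 * (e * L * G) ^+ 2 + 2 / 3 * (rho * x * e ^+ 2 * G ^+ 2) ^+ 2).
  rewrite ler_wpM2l//; have := sqr_ge0 (e * L * G).
  have := sqr_ge0 (rho * x * e ^+ 2 * G ^+ 2); lra.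
have t3 : 0 <= e ^+ 4 * L ^+ 2 * G ^+ 2 * x ^+ 3.
  rewrite mulr_ge0 ?exprn_ge0 ?(ltW x0)// mulr_ge0 ?sqr_ge0//.
  by rewrite mulr_ge0 ?sqr_ge0// exprn_ge0// ltW.
have t0 : 0 <= x * e * mu * r ^+ 2 by rewrite mulr_ge0// mulr_ge0// ltW.
have t4 : 4 * e ^+ 2 * x * L ^+ 2 * (x * e * L * r) ^+ 2 <= x * e * mu / 16 * r ^+ 2.
  have -> : 4 * e ^+ 2 * x * L ^+ 2 * (x * e * L * r) ^+ 2 =
     4 * (x * e) * e * (x * e * L ^+ 2) ^+ 2 * r ^+ 2 by ring.
  rewrite ler_wpM2r//.
  have s0 : 0 <= x * e * L ^+ 2 by rewrite mulr_ge0 ?sqr_ge0// ltW.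
  have s1 : (x * e * L ^+ 2) ^+ 2 <= (mu / 32) ^+ 2 by rewrite lerXn2r ?nnegrE//; lra.
  have s2 : 0 <= 4 * (x * e) * e by rewrite !mulr_ge0// ltW.
  apply: le_trans (ler_wpM2l s2 s1) _.
  have s3 : 0 <= x * e * mu by rewrite mulr_ge0// ltW.
  have := ler_wpM2l s3 emu; lra.
(* Of 63/32 the quadratic loss leaves 15/8; the cross term takes 1 and [t4] takes 1/16, leaving
   13/16 >= 3/4. *)
have t5 : A * r ^+ 2 <= (1 - 15 / 8 * (x * e * mu)) * r ^+ 2.
  rewrite ler_wpM2r//; apply: le_trans hA _.
  have s3 : 0 <= x * e * mu by rewrite !mulr_ge0// ltW.
  have := ler_wpM2l s3 epoch_rate_le; lra.
lra.
Qed.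

Section OneEpoch.
Variables (R : realType) (d m : nat).
Local Notation n := m.+2.
Local Notation V := 'rV[R]_d.
Local Notation N := (#|{: 'S_n}|%:R : R).
Variables (g : 'I_n -> V -> V) (L mu eta rho Gs D : R) (xs : V) (H : V -> 'M[R]_d).
Local Notation F := (mean_field g).
Local Notation G := (Gs + 2 * L * D).

Hypothesis mu_gt0 : 0 < mu.
Hypothesis mu_le : mu <= L.
Hypothesis eta_gt0 : 0 < eta.
Hypothesis step_le : n%:R * eta <= mu / (32 * L ^+ 2).
Hypothesis g_lip : forall c x y, enorm (g c x - g c y) <= L * enorm (x - y).
Hypothesis F_xs : F xs = 0.
Hypothesis F_mono : forall x, mu * enorm (x - xs) ^+ 2 <= dot (F x) (x - xs).
Hypothesis g_xs : forall c, enorm (g c xs) <= Gs.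
Hypothesis D_ge : Gs / (2 * L) <= D.
Hypothesis rho_ge0 : 0 <= rho.
Hypothesis F_taylor : forall x e,
  enorm (F (x + e) - F x - e *m H x) <= rho / 2 * enorm e ^+ 2.
Hypothesis H_le : forall x e, enorm (e *m H x) <= L * enorm e.

Let L_gt0 : 0 < L.
Proof. exact: lt_le_trans mu_le. Qed.

Let L_ge0 : 0 <= L.
Proof. exact: ltW. Qed.

Let h_gt0 : 0 < n%:R * eta.
Proof. by rewrite mulr_gt0// ltr0n. Qed.

Let hLL : n%:R * eta * L ^+ 2 <= mu / 32.
Proof. by rewrite -ler_pdivlMr ?exprn_gt0// -mulrA -invfM. Qed.

Let hL : n%:R * eta * L <= 1 / 32.
Proof.
rewrite -(ler_pM2r L_gt0) (_ : _ * L * L = n%:R * eta * L ^+ 2); last by ring.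
by apply: le_trans hLL _; move: mu_le; lra.
Qed.

Lemma epoch_rate_le : n%:R * eta * mu <= 1 / 32.
Proof. by apply: le_trans hL; rewrite ler_wpM2l// ltW. Qed.

Let eta_le : eta <= n%:R * eta / 2.
Proof.
have n2 : 2 <= n%:R :> R by rewrite (ler_nat _ 2).
have := ler_wpM2r (ltW eta_gt0) n2; lra.
Qed.

Let Gs_ge0 : 0 <= Gs.
Proof. exact: le_trans (enorm_ge0 _) (g_xs ord0). Qed.

Let D_ge0 : 0 <= D.
Proof. by apply: le_trans D_ge; rewrite divr_ge0// mulr_ge0. Qed.

Let G_ge0 : 0 <= G.
Proof. by rewrite addr_ge0// !mulr_ge0. Qed.

(** The term Gs/(2L) in the maximum defining [D] serves this bound. *)
Let G_le : G <= 4 * L * D.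
Proof. move: D_ge; rewrite ler_pdivrMr ?mulr_gt0// => h; lra. Qed.

Let F_le x : enorm (F x) <= L * enorm (x - xs).
Proof. by have := mean_field_lip g_lip x xs; rewrite F_xs subr0. Qed.

Let emu : eta * mu <= 1 / 64.
Proof.
have : eta * mu <= n%:R * eta / 2 * mu by rewrite ler_wpM2r// ltW.
by move: epoch_rate_le; lra.
Qed.

(** Expanding the square, [F_mono] gives -2 s mu and the Lipschitz bound gives s (s L^2) <= s mu /
    32. It serves both for [s = eta] and for a whole epoch, [s = n * eta]. *)
Lemma gd_step_contract (s : R) x : 0 <= s -> s * L ^+ 2 <= mu / 32 ->
  enorm (x - s *: F x - xs) ^+ 2 <= (1 - 63 / 32 * (s * mu)) * enorm (x - xs) ^+ 2.
Proof.
move=> s0 sL; rewrite addrAC [leLHS]sqr_enormD enormN enormZ ger0_norm// dotNr dotZr dotC.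
have u0 := enorm_ge0 (x - xs).
have h1 := ler_wpM2l s0 (F_mono x).
have h2 : (s * enorm (F x)) ^+ 2 <= s * (s * L ^+ 2) * enorm (x - xs) ^+ 2.
  rewrite (_ : _ * _ * _ = (s * (L * enorm (x - xs))) ^+ 2); last by ring.
  by rewrite lerXn2r ?nnegrE ?mulr_ge0 ?enorm_ge0// ler_wpM2l.
have su0 : 0 <= s * enorm (x - xs) ^+ 2 by rewrite mulr_ge0 ?sqr_ge0.
have h3 := ler_wpM2l su0 sL.
lra.
Qed.

Section Start.
Variable y : V.
Hypothesis y_le : enorm (y - xs) <= D.
Local Notation r := (enorm (y - xs)).

Lemma g_bound c x : enorm (x - xs) <= 2 * D -> enorm (g c x) <= G.
Proof.
move=> xD; rewrite -[g c x](subrK (g c xs)) addrC.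
apply: le_trans (ler_enormD _ _) _; apply: lerD (g_xs c) _.
apply: le_trans (g_lip _ _ _) _.
by rewrite (mulrC 2) -mulrA ler_wpM2l.
Qed.

Lemma sqr_gd_le i :
  enorm (gd g eta y i - xs) ^+ 2 <= (1 - 63 / 32 * (eta * mu)) ^+ i * r ^+ 2.
Proof.
elim: i => [|i IH]; first by rewrite expr0 mul1r.
rewrite [_ ^+ i.+1]exprS -mulrA /=.
have etaLL : eta * L ^+ 2 <= mu / 32.
  apply: le_trans hLL; rewrite ler_wpM2r ?sqr_ge0//.
  by apply: le_trans eta_le _; move: h_gt0; lra.
apply: le_trans (gd_step_contract _ (ltW eta_gt0) etaLL) _.
rewrite ler_wpM2l//.
by move: emu; lra.
Qed.

Lemma gd_le i : enorm (gd g eta y i - xs) <= r.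
Proof.
rewrite -(@ler_pXn2r _ 2) ?nnegrE ?enorm_ge0//.
apply: le_trans (sqr_gd_le i) _; rewrite ler_piMl ?sqr_ge0//.
have em0 : 0 < eta * mu by rewrite mulr_gt0.
by rewrite exprn_ile1//; move: emu; lra.
Qed.

(** Proportionality to [r] lets the recentred noise of [sum_sqr_err_end] be absorbed by the
    contraction. *)
Lemma gd_dist_le i : (i <= n)%N -> enorm (gd g eta y i - y) <= n%:R * eta * L * r.
Proof.
move=> iln; apply: (@le_trans _ _ (i%:R * (eta * L * r))); last first.
  by rewrite -!mulrA ler_wpM2r ?ler_nat// !mulr_ge0 ?enorm_ge0// ltW.
elim: i {iln} => [|i IH]; first by rewrite subrr enorm0 mul0r.
rewrite -[i.+1%:R]natr1 mulrDl mul1r /= addrAC.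
apply: le_trans (ler_enormB _ _) _; apply: lerD IH _.
rewrite enormZ gtr0_norm// -mulrA ler_wpM2l ?(ltW eta_gt0)//.
by apply: le_trans (F_le _) _; rewrite ler_wpM2l// gd_le.
Qed.

(** A joint induction: staying within 2 D bounds the next gradient by G, and the total drift n eta G
    <= 4 n eta L D <= D/8 keeps the iterate within 2 D. *)
Lemma inner_dist (p : 'S_n) i : (i <= n)%N ->
  enorm (inner g eta p y i - y) <= i%:R * (eta * G) /\
  enorm (inner g eta p y i - xs) <= 2 * D.
Proof.
elim: i => [|i IH] iln.
  split; first by rewrite /= subrr enorm0 mul0r.
  by apply: le_trans y_le _; move: D_ge0; lra.
have [IH1 IH2] := IH (ltnW iln).
have le1 : enorm (inner g eta p y i.+1 - y) <= i.+1%:R * (eta * G).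
  rewrite -[i.+1%:R]natr1 mulrDl mul1r /= addrAC.
  apply: le_trans (ler_enormB _ _) _; apply: lerD IH1 _.
  by rewrite enormZ gtr0_norm// ler_wpM2l ?(ltW eta_gt0)// g_bound.
split=> //; rewrite -[_ - xs](subrKA y) addrC.
apply: le_trans (ler_enormD _ _) _.
have : i.+1%:R * (eta * G) <= n%:R * (eta * G).
  by rewrite ler_wpM2r ?ler_nat// mulr_ge0// ltW.
have : n%:R * eta * G <= n%:R * eta * (4 * L * D) by rewrite ler_wpM2l// ltW.
have := ler_wpM2r D_ge0 hL.
move: D_ge0 le1 y_le; set A := enorm _; set B := enorm _; set C := n%:R.
move: (G) (i.+1%:R) => G' I; lra.
Qed.

(** For every permutation, an epoch is one step on F of size h = n eta plus a perturbation. The step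
    gains 63/64 h mu D and the perturbation costs at most h mu D / 16, so the next epoch starts in
    the same ball. *)
Lemma inner_end (p : 'S_n) : enorm (inner g eta p y n - xs) <= D.
Proof.
have sumE i : inner g eta p y i =
    y - eta *: \sum_(0 <= j < i) g (p (inord j)) (inner g eta p y j).
  elim: i => [|i IH]; first by rewrite big_geq// scaler0 subr0.
  by rewrite big_nat_recr//= {1}IH scalerDr opprD addrA.
have FyE : \sum_(0 <= j < n) g (p (inord j)) y = n%:R *: F y.
  rewrite scalerA divff ?pnatr_eq0// scale1r big_mkord.
  rewrite [RHS](reindex_inj (@perm_inj _ p)).
  by apply: eq_bigr => j _; rewrite inord_val.
have -> : inner g eta p y n - xs = (y - (n%:R * eta) *: F y - xs) -
    eta *: \sum_(0 <= j < n) (g (p (inord j)) (inner g eta p y j) - g (p (inord j)) y).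
  rewrite sumrB FyE {1}sumE.
  by move: (F y) (\sum_(0 <= j < n) _) => u v; apply/rowP => k; rewrite !mxE; ring.
apply: le_trans (ler_enormB _ _) _; rewrite enormZ gtr0_norm//.
have h0 := ltW h_gt0.
have hm0 : 0 <= n%:R * eta * mu by rewrite mulr_ge0// ltW.
have le1 : enorm (y - (n%:R * eta) *: F y - xs) <=
    (1 - 63 / 64 * (n%:R * eta * mu)) * D.
  apply: (@le_trans _ _ ((1 - 63 / 64 * (n%:R * eta * mu)) * r)); last first.
    by rewrite ler_wpM2l//; move: epoch_rate_le; lra.
  rewrite -(@ler_pXn2r _ 2) ?nnegrE ?enorm_ge0// ?mulr_ge0 ?enorm_ge0//; last first.
    by move: epoch_rate_le; lra.
  apply: le_trans (gd_step_contract y h0 hLL) _.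
  rewrite exprMn ler_wpM2r ?sqr_ge0//.
  by have := sqr_ge0 (n%:R * eta * mu); lra.
have le2 : enorm (\sum_(0 <= j < n)
      (g (p (inord j)) (inner g eta p y j) - g (p (inord j)) y))
    <= L * (eta * G) * (n%:R ^+ 2 / 2).
  apply: le_trans (ler_enorm_sum _ _ _) _.
  apply: (@le_trans _ _ (\sum_(0 <= j < n) L * (eta * G) * j%:R)).
    rewrite !big_nat; apply: ler_sum => j /andP[_ jn].
    apply: le_trans (g_lip _ _ _) _; rewrite -mulrA ler_wpM2l// mulrC.
    exact: (inner_dist p (ltnW jn)).1.
  rewrite -mulr_sumr ler_wpM2l ?sum_nat_le// mulr_ge0// mulr_ge0//.
  exact: ltW.
have le3 := ler_wpM2l (ltW eta_gt0) le2.
have le4 : eta * (L * (eta * G) * (n%:R ^+ 2 / 2)) <= n%:R * eta * mu / 16 * D.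
  have -> : eta * (L * (eta * G) * (n%:R ^+ 2 / 2)) =
    (n%:R * eta) ^+ 2 * L / 2 * G by ring.
  have c0 : 0 <= (n%:R * eta) ^+ 2 * L / 2 by rewrite divr_ge0// mulr_ge0// sqr_ge0.
  apply: le_trans (ler_wpM2l c0 G_le) _.
  have hD0 : 0 <= n%:R * eta * D by rewrite mulr_ge0.
  have := ler_wpM2l hD0 hLL; lra.
have hmD0 : 0 <= n%:R * eta * mu * D by rewrite mulr_ge0.
apply: le_trans (lerD le1 (le_trans le3 le4)) _; lra.
Qed.

(** With rate q = 3/4 n eta mu, the bound has the form (1 - q) r^2 + q B, so iterating it leaves a
    noise floor of at most B. *)
Lemma one_epoch :
  \sum_(p : 'S_n) enorm (inner g eta p y n - xs) ^+ 2 <=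
  N * ((1 - 3 / 4 * (n%:R * eta * mu)) * r ^+ 2 + 3 / 4 * (n%:R * eta * mu) *
    (64 * L ^+ 2 * G ^+ 2 / mu ^+ 2 * eta ^+ 2
     + 6 * L ^+ 2 * G ^+ 2 / mu * n%:R ^+ 2 * eta ^+ 3
     + 8 * rho ^+ 2 * G ^+ 4 / (9 * mu ^+ 2) * n%:R ^+ 2 * eta ^+ 4)).
Proof.
have a01 : 0 <= 63 / 32 * (eta * mu) <= 1.
  have em0 : 0 < eta * mu by rewrite mulr_gt0.
  by apply/andP; split; move: emu; lra.
have ib c p i : (i <= n)%N -> enorm (g c (inner g eta p y i)) <= G.
  by move=> iln; apply: g_bound; exact: (inner_dist p iln).2.
have gb c i : (i <= n)%N -> enorm (g c (gd g eta y i)) <= G.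
  move=> _; apply: g_bound; apply: le_trans (gd_le i) _.
  by apply: le_trans y_le _; move: D_ge0; lra.
have E2 := sum_sqr_err_end L_ge0 eta_gt0 g_lip hL G_ge0 gb gd_dist_le.
have E1 := mean_err L_ge0 eta_gt0 g_lip hL G_ge0 ib gb rho_ge0 F_taylor H_le (leqnn n).
set z := gd g eta y n in E1 E2.
have zle := sqr_gd_le n; rewrite -/z in zle.
have q1 := growth_le L_ge0 eta_gt0 hL (leqnn n).
have q0 : 0 <= (1 + eta * L) ^+ n by rewrite exprn_ge0// addr_ge0// mulr_ge0// ltW.
have N0 : 0 <= N by [].
have e0 := ltW eta_gt0.
set q := (1 + eta * L) ^+ n in E1 q1 q0.
set M := q * (eta * _) in E1.
have ME : M = q * (n%:R * eta *
    (64 / 31 * (eta * L * G) + 9 / 16 * (rho * n%:R * eta ^+ 2 * G ^+ 2))).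
  by rewrite /M; ring.
have M0 : 0 <= M.
  rewrite ME mulr_ge0// mulr_ge0 ?(ltW h_gt0)// addr_ge0// mulr_ge0//; last 2 first.
    by rewrite mulr_ge0 ?sqr_ge0// mulr_ge0 ?sqr_ge0// mulr_ge0.
  by rewrite !mulr_ge0.
have expand : \sum_(p : 'S_n) enorm (inner g eta p y n - xs) ^+ 2 =
    N * enorm (z - xs) ^+ 2 +
    2 * dot (z - xs) (\sum_(p : 'S_n) (inner g eta p y n - z)) +
    \sum_(p : 'S_n) enorm (inner g eta p y n - z) ^+ 2.
  rewrite dot_sumr mulr_sumr mulr_natl -sumr_const -!big_split.
  apply: eq_bigr => p _ /=.
  by rewrite -sqr_enormD; congr (enorm _ ^+ 2); rewrite [RHS]addrC subrKA.
rewrite expand.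
have dle : 2 * dot (z - xs) (\sum_(p : 'S_n) (inner g eta p y n - z)) <=
    N * (2 * (r * M)).
  rewrite (_ : N * (2 * (r * M)) = 2 * (r * (N * M))); last by ring.
  rewrite ler_wpM2l//; apply: le_trans (dot_le_enorm _ _) _.
  exact: ler_pM (enorm_ge0 _) (enorm_ge0 _) (gd_le n) E1.
have Mle := drift_arith r M h_gt0 mu_gt0.
have noise : M ^+ 2 / (n%:R * eta * mu) <= n%:R * eta / mu *
   (30 * (eta * L * G) ^+ 2 + 1 / 2 * (rho * n%:R * eta ^+ 2 * G ^+ 2) ^+ 2).
  rewrite ME; apply: epoch_noise_arith => //; first by rewrite !mulr_ge0.
  by rewrite mulr_ge0 ?sqr_ge0// mulr_ge0 ?sqr_ge0// mulr_ge0.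
have n0 : 0 < n%:R :> R by rewrite ltr0n.
have fin := epoch_bound_arith n0 eta_gt0 mu_gt0 L_gt0 hLL epoch_rate_le emu
  (pow_one_sub_le n a01) (le_trans Mle (lerD (lexx _) noise)) (lexx _).
have := ler_wpM2l N0 fin; apply: le_trans.
rewrite [leRHS]mulrDr; apply: lerD E2; rewrite [leRHS]mulrDr; apply: lerD dle.
by rewrite ler_wpM2l.
Qed.

End Start.
End OneEpoch.

(** * Independent epochs *)

Section Resampling.
Variables (R : realType) (P : finType) (X : Type) (K : nat).

Definition set_coord (k : 'I_K) (s : {ffun 'I_K -> P}) (p : P) : {ffun 'I_K -> P} :=
  [ffun i => if i == k then p else s i].

(** Redrawing one coordinate preserves the uniform law: exchanging coordinate [k] with the fresh
    draw is an involution on pairs. *)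
Lemma sum_resample (M : nmodType) (k : 'I_K) (h : {ffun 'I_K -> P} -> M) :
  \sum_s \sum_p h (set_coord k s p) = (\sum_s h s) *+ #|P|.
Proof.
rewrite pair_big_dep /=.
pose swap (u : {ffun 'I_K -> P} * P) := (set_coord k u.1 u.2, u.1 k).
have swapK : involutive swap.
  move=> [s p]; rewrite /swap /=; congr pair; last by rewrite ffunE eqxx.
  by apply/ffunP => i; rewrite !ffunE; case: eqP => // ->.
rewrite (reindex_inj (inv_inj swapK)) /=.
rewrite (eq_bigr (fun u => h u.1)) => [|[s p] _ /=]; last first.
  by congr h; apply/ffunP => i; rewrite !ffunE; case: eqP => // ->.
rewrite -(pair_big_dep xpredT (fun _ _ => true) (fun s (_ : P) => h s)) /=.
by rewrite -sumrMnl; apply: eq_bigr => s _; rewrite sumr_const.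
Qed.

Variables (step : P -> X -> X) (x0 : X) (p0 : P).

Definition extend (s : {ffun 'I_K -> P}) (k : nat) : P :=
  if insub k is Some i then s i else p0.

Fixpoint trajectory (s : nat -> P) (k : nat) : X :=
  if k is j.+1 then step (s j) (trajectory s j) else x0.

Lemma eq_trajectory (s t : nat -> P) k :
  (forall j, (j < k)%N -> s j = t j) -> trajectory s k = trajectory t k.
Proof.
elim: k => //= k IH st; rewrite st// IH// => j jk.
by rewrite st// ltnW.
Qed.

(** The tower property in finite form: resampling coordinate [k] leaves the state at time [k]
    unchanged, so the one-step bound averages over the past. *)
Lemma sum_trajectory_le (Inv : X -> Prop) (phi : X -> R) (q B : R) :
  Inv x0 -> (forall p x, Inv x -> Inv (step p x)) ->
  (forall x, Inv x ->
     \sum_p phi (step p x) <= #|P|%:R * ((1 - q) * phi x + q * B)) ->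
  0 <= q <= 1 -> 0 <= B ->
  \sum_(s : {ffun 'I_K -> P}) phi (trajectory (extend s) K) <=
  #|{ffun 'I_K -> P}|%:R * ((1 - q) ^+ K * phi x0 + B).
Proof.
move=> I0 Istep phi_step /andP[q0 q1] B0.
have Ipath s k : Inv (trajectory s k) by elim: k => //= k; exact: Istep.
have P0 : 0 < #|P|%:R :> R by rewrite ltr0n; apply/card_gt0P; exists p0.
(* The factor 1 - (1 - q)^k makes the induction close exactly. *)
suff main k : (k <= K)%N -> \sum_(s : {ffun 'I_K -> P}) phi (trajectory (extend s) k) <=
  #|{ffun 'I_K -> P}|%:R * ((1 - q) ^+ k * phi x0 + (1 - (1 - q) ^+ k) * B).
  apply: le_trans (main K (leqnn K)) _; rewrite ler_wpM2l// lerD2l ler_piMl//.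
  by rewrite gerBl exprn_ge0// subr_ge0.
elim: k => [|k IH] kK.
  by rewrite expr0 subrr mul0r addr0 mul1r /= sumr_const mulr_natl.
rewrite -(ler_pM2l P0) [X in X <= _]mulr_natl.
rewrite -(sum_resample (Ordinal kK) (fun s => phi (trajectory (extend s) k.+1))).
apply: (@le_trans _ _ (\sum_(s : {ffun 'I_K -> P})
    #|P|%:R * ((1 - q) * phi (trajectory (extend s) k) + q * B))).
  apply: ler_sum => s _; apply: le_trans (phi_step _ (Ipath _ _)).
  rewrite le_eqVlt; apply/orP; left; apply/eqP/eq_bigr => p _ /=.
  have -> : extend (set_coord (Ordinal kK) s p) k = p.
    by rewrite /extend insubT ffunE /= (_ : _ == _)//; apply/eqP/val_inj.
  congr (phi (step p _)); apply: eq_trajectory => j jk.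
  rewrite /extend insubT ?(ltn_trans jk)// => jK; rewrite ffunE ifF//.
  by apply/eqP => /(congr1 val) /= jk'; rewrite jk' ltnn in jk.
rewrite -mulr_sumr ler_pM2l// big_split/= -mulr_sumr sumr_const -[X in _ + X]mulr_natl.
have := ler_wpM2l (_ : 0 <= 1 - q) (IH (ltnW kK)).
rewrite subr_ge0 => /(_ q1) h.
rewrite exprS; apply: le_trans (lerD h (lexx _)) _; lra.
Qed.

End Resampling.

(** * Gradients and Hessians *)

Fact taylor_arith (R : realFieldType) (p q b r c : R) :
  p - b * 1 - r * c * 1 ^+ 2 <= q - b * 0 - r * c * 0 ^+ 2 -> p - q - b <= r * c.
Proof. lra. Qed.

Section Calculus.
Variables (R : realType) (d : nat).
Local Notation V := 'rV[R]_d.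

Lemma diff_dot_grad (f : V -> R) (x v : V) : 'd f x v = dot (grad f x) v.
Proof.
rewrite [v in LHS]row_sum_delta linear_sum; apply: eq_bigr => j _.
by rewrite linearZ mxE mulrC.
Qed.

Lemma is_derive_line (W : normedModType R) (f : V -> W) (x v : V) (t : R) :
  differentiable f (x + t *: v) ->
  is_derive t 1 (fun s : R => f (x + s *: v)) ('d f (x + t *: v) v).
Proof.
move=> df.
have quotE : (fun h : R => h^-1 *: (((fun s : R => f (x + s *: v)) \o shift t) (h *: 1)
      - f (x + t *: v))) =
    (fun h : R => h^-1 *: ((f \o shift (x + t *: v)) (h *: v) - f (x + t *: v))).
  apply/funext => h /=; congr (_ *: (f _ - _)).
  by rewrite [h *: 1]mulr1 scalerDl addrCA.
apply: DeriveDef; last by rewrite -deriveE// /derive quotE.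
by rewrite /derivable quotE; exact: diff_derivable.
Qed.

Lemma is_derive_line_dot (f : V -> V) (x v w : V) (t : R) :
  differentiable f (x + t *: v) ->
  is_derive t 1 (fun s : R => dot (f (x + s *: v)) w)
    (dot (v *m jacobian f (x + t *: v)) w).
Proof.
move=> df; have [dv ve] := is_derive_line df.
have dj j : is_derive t 1 (fun s : R => f (x + s *: v) ord0 j * w ord0 j)
    ((v *m jacobian f (x + t *: v)) ord0 j * w ord0 j).
  have dvj := (derivable_mxP _ _ _).1 dv ord0 j.
  apply: DeriveDef.
    have -> : (fun s : R => f (x + s *: v) ord0 j * w ord0 j) =
        (w ord0 j) \*: (fun s : R => f (x + s *: v) ord0 j).
      by apply/funext => s; rewrite /= mulrC.
    exact: derivableZ.
  have -> : (fun s : R => f (x + s *: v) ord0 j * w ord0 j) =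
        (w ord0 j) \*: (fun s : R => f (x + s *: v) ord0 j).
    by apply/funext => s; rewrite /= mulrC.
  rewrite deriveZ//= [LHS]mulrC; congr (_ * _).
  have -> : v *m jacobian f (x + t *: v) = 'D_1 (fun s : R => f (x + s *: v)) t.
    by rewrite ve -deriveEjacobian// deriveE.
  by rewrite derive_mx// mxE.
have -> : (fun s : R => dot (f (x + s *: v)) w) =
    \sum_(j < d) (fun s : R => f (x + s *: v) ord0 j * w ord0 j).
  by apply/funext => s; rewrite fct_sumE.
exact: is_derive_sum.
Qed.

Lemma opnorm_le (A : 'M[R]_d) (v : V) : enorm (v *m A) <= opnorm A * enorm v.
Proof.
have [v0|v0] := eqVneq (enorm v) 0.
  by rewrite (enorm_eq0 v0) mul0mx enorm0 mulr0.
have vp : 0 < enorm v by rewrite lt_def v0 enorm_ge0.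
have -> : v = enorm v *: ((enorm v)^-1 *: v) by rewrite scalerA divff ?scale1r.
rewrite -scalemxAl !enormZ gtr0_norm// normfV gtr0_norm// mulVf// mulr1 mulrC.
rewrite ler_wpM2r// ?(ltW vp)//.
apply: ub_le_sup; last first.
  exists ((enorm v)^-1 *: v) => //=.
  by rewrite enormZ normfV gtr0_norm// mulVf.
(* [sup] dominates its set only if that set is bounded. The squared Frobenius norm [S] gives the
   bound 1 + S, since S <= (1 + S)^2. *)
pose S := \sum_(j < d) enorm (col j A)^T ^+ 2.
have S0 : 0 <= S by apply: sumr_ge0 => j _; rewrite sqr_ge0.
exists (1 + S) => _ [u /= u1 <-].
rewrite -(@ler_pXn2r _ 2) ?nnegrE ?enorm_ge0 ?addr_ge0//.
apply: (@le_trans _ _ S); last by have := sqr_ge0 S; lra.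
rewrite sqr_enorm; apply: ler_sum => j _; rewrite -expr2.
have -> : (u *m A) ord0 j = dot u (col j A)^T.
  by rewrite mxE; apply: eq_bigr => k _; rewrite !mxE.
rewrite -real_normK ?num_real// lerXn2r ?nnegrE ?enorm_ge0//.
apply: le_trans (norm_dot_le _ _) _.
by rewrite ler_piMl ?enorm_ge0.
Qed.

(** Difference quotients from the right are at most K + h M. Strong convexity yields such a bound
    only for [t] in [0, 1]. *)
Lemma derive_le_right (phi : R -> R) (K M : R) :
  derivable phi 0 1 ->
  (forall t, 0 < t <= 1 -> phi t <= phi 0 + t * (K + t * M)) ->
  'D_1 phi 0 <= K.
Proof.
move=> dphi phi_le; apply/ler_addgt0Pr => e e0.
rewrite ['D_1 phi 0]cvg_at_rightE//; apply: limr_le.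
  rewrite -(cvg_at_rightE (fun h : R => h^-1 *: ((phi \o shift 0) (h *: 1) - phi 0)))//.
  apply: cvg_trans dphi; apply: cvg_app.
  move=> A [r r0 Ar]; exists r => // x xr x0; apply: Ar => //.
  exact: lt0r_neq0.
near=> h.
have h0 : 0 < h by near: h; exact: nbhs_right_gt.
have h1 : h <= 1 by near: h; exact: nbhs_right_le.
have M1 : 0 < 1 + `|M| by rewrite ltr_pwDl.
have h2 : h <= e / (1 + `|M|) by near: h; apply: nbhs_right_le; rewrite divr_gt0.
rewrite /= addr0 [h *: 1]mulr1 -[_ *: _]/(h^-1 * _) ler_pdivrMl//.
have h01 : 0 < h <= 1 by rewrite h0.
have := phi_le _ h01.
have : h * M <= e.
  move: h2; rewrite ler_pdivlMr// => h2; apply: le_trans h2.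
  by rewrite ler_wpM2l ?(ltW h0)//; have := ler_norm M; lra.
move=> hM; have := ler_wpM2l (ltW h0) hM; lra.
Unshelve. all: by end_near. Qed.

(** Fermat's rule along the gradient direction, where the derivative is the squared norm of the
    gradient. *)
Lemma minimizer_grad0 (f : V -> R) (xs : V) :
  (forall x, differentiable f x) -> minimizer f xs -> grad f xs = 0.
Proof.
move=> df fmin; apply: enorm_eq0; apply/eqP; rewrite -sqrf_eq0 sqr_enorm.
rewrite -diff_dot_grad; set v := grad f xs.
pose phi (s : R) := f (xs + s *: v).
have dphi (t : R) : is_derive t 1 phi ('d f (xs + t *: v) v) by exact: is_derive_line.
have d0 : is_derive (0 : R) 1 phi 0.
  apply: (@derive1_at_min _ phi (-1) 1).
  - by rewrite lerNl (le_trans _ ler01)// oppr_le0.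
  - by move=> t _; have [] := dphi t.
  - by rewrite in_itv/= ltr01 oppr_lt0 ltr01.
  - by move=> t _; rewrite /phi scale0r addr0; exact: fmin.
have := @derive_val _ _ _ _ _ _ _ (dphi 0).
by rewrite (@derive_val _ _ _ _ _ _ _ d0) scale0r addr0 => <-.
Qed.

(** Adding the first-order inequalities from [x] to [xs] and back cancels the function values and
    doubles mu/2. *)
Lemma strongly_convex_grad_mono (f : V -> R) (mu : R) (xs : V) :
  (forall x, differentiable f x) -> strongly_convex mu f -> minimizer f xs ->
  forall x, mu * enorm (x - xs) ^+ 2 <= dot (grad f x) (x - xs).
Proof.
move=> df sc fmin x.
have along y z : dot (grad f y) (z - y) <= f z - f y - mu / 2 * enorm (y - z) ^+ 2.
  pose phi (s : R) := f (y + s *: (z - y)).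
  have dphi : is_derive (0 : R) 1 phi ('d f (y + 0 *: (z - y)) (z - y)).
    by exact: is_derive_line.
  have [dv ve] := dphi.
  rewrite scale0r addr0 diff_dot_grad in ve; rewrite -ve.
  apply: (derive_le_right (M := mu / 2 * enorm (y - z) ^+ 2)) => // t /andP[t0 t1].
  have t01 : 0 <= t <= 1 by rewrite ltW.
  have := sc z y t t01; rewrite /phi scale0r addr0 enorm_distC.
  have -> : y + t *: (z - y) = t *: z + (1 - t) *: y.
    by apply/rowP => j; rewrite !mxE; ring.
  lra.
have h1 := along x xs; have h2 := along xs x.
move: h1 h2; rewrite (minimizer_grad0 df fmin) dot0l -(opprB x xs) dotNr.
by rewrite enormN; lra.
Qed.

(** Paired with a fixed [w], the remainder along the segment minus its quadratic bound is a real
    function [psi], nonincreasing because the Hessian is Lipschitz. *)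
Lemma grad_taylor (f : V -> R) (rho : R) : 0 <= rho ->
  twice_differentiable f ->
  (forall x y, opnorm (hessian f x - hessian f y) <= rho * enorm (x - y)) ->
  forall x e : V, enorm (grad f (x + e) - grad f x - e *m hessian f x)
    <= rho / 2 * enorm e ^+ 2.
Proof.
move=> rho0 df hH x e; apply: enorm_le_of_dot => [|w].
  by rewrite mulr_ge0 ?sqr_ge0// divr_ge0.
pose c := enorm e ^+ 2 * enorm w.
pose b := dot (e *m hessian f x) w.
pose psi := (fun s : R => dot (grad f (x + s *: e)) w) - (b \*: (@id R))
   - ((rho / 2 * c) \*: ((@id R) ^+ 2)).
have dpsi (t : R) : is_derive t 1 psi
    (dot (e *m hessian f (x + t *: e)) w - b - rho * c * t).
  have d1 := is_derive_line_dot w (df (x + t *: e)).2.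
  apply: is_derive_eq.
  rewrite /= expr1 ![_ *: 1]mulr1 -[_ *: (2 * t)]/(_ * _) /hessian; lra.
have c0 : 0 <= c by rewrite mulr_ge0 ?sqr_ge0 ?enorm_ge0.
have : psi 1 <= psi 0.
  have dv t : t \in `]0, 1[%R -> derivable psi t 1 by move=> _; have [] := dpsi t.
  have cont : {within `[0, 1], continuous psi}.
    by apply: derivable_within_continuous => t _; have [] := dpsi t.
  apply: (ler0_derive1_le_cc dv _ cont); rewrite ?in_itv/= ?lexx ?ler01//.
  move=> t; rewrite in_itv/= => /andP[t0 _].
    rewrite derive1E (@derive_val _ _ _ _ _ _ _ (dpsi t)) /b -dotNl -dotDl -mulmxBr.
    rewrite subr_le0; apply: le_trans (dot_le_enorm _ _) _.
    have xE : x + t *: e - x = t *: e by rewrite (addrC x) addrK.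
    have := hH (x + t *: e) x; rewrite xE enormZ gtr0_norm// => hHt.
    have := opnorm_le (hessian f (x + t *: e) - hessian f x) e.
    have := ler_wpM2r (enorm_ge0 e) hHt; move=> h1 h2.
    have := ler_wpM2r (enorm_ge0 w) (le_trans h2 h1).
    by move/le_trans; apply; rewrite /c; lra.
have psiE t : psi t = dot (grad f (x + t *: e)) w - b * t - rho / 2 * c * t ^+ 2.
  by [].
rewrite !psiE scale1r scale0r addr0 !dotDl !dotNl -/b.
rewrite -[X in _ -> _ <= X]mulrA -/c; exact: taylor_arith.
Qed.

(** Apply both bounds to [t *: e] and divide by [t]: the quadratic remainder then costs t rho |e|^2,
    below any [eps] for small [t]. *)
Lemma linear_part_le (phi : V -> V) (A : 'M[R]_d) (x : V) (L rho : R) :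
  0 <= rho -> (forall y z, enorm (phi y - phi z) <= L * enorm (y - z)) ->
  (forall e, enorm (phi (x + e) - phi x - e *m A) <= rho * enorm e ^+ 2) ->
  forall e, enorm (e *m A) <= L * enorm e.
Proof.
move=> rho0 lip approx e; apply/ler_addgt0Pr => eps eps0.
have c0 : 0 <= rho * enorm e ^+ 2 by rewrite mulr_ge0 ?sqr_ge0.
have c1 : 0 < 1 + rho * enorm e ^+ 2 by rewrite ltr_pwDl.
pose t := eps / (1 + rho * enorm e ^+ 2).
have t0 : 0 < t by rewrite divr_gt0.
have tc : t * (rho * enorm e ^+ 2) <= eps.
  have -> : eps = t * (1 + rho * enorm e ^+ 2) by rewrite divfK// gt_eqF.
  by rewrite ler_pM2l// lerDr.
rewrite -(ler_pM2l t0).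
apply: (@le_trans _ _ (L * enorm (t *: e) + rho * enorm (t *: e) ^+ 2)).
  rewrite -[t in leLHS]gtr0_norm// -enormZ scalemxAl.
  set u := phi (x + t *: e) - phi x.
  rewrite -[_ *m A](subKr u); apply: le_trans (ler_enormB _ _) _.
  apply: lerD (approx _).
  by apply: le_trans (lip _ _) _; rewrite (addrC x) addrK.
rewrite enormZ gtr0_norm//; have := ler_wpM2l (ltW t0) tc; lra.
Qed.

End Calculus.

(** * Random reshuffling *)

Section Average.
Variables (R : realType) (d : nat).

Lemma mean_field_grad (m : nat) (f : 'I_m.+2 -> 'rV[R]_d -> R) (x : 'rV[R]_d) :
  (forall i x, differentiable (f i) x) ->
  mean_field (fun c => grad (f c)) x = grad (average f) x.
Proof.
move=> df; have dv i v : derivable (f i) x v by apply: diff_derivable.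
have dsum : differentiable (\sum_(i < m.+2) f i) x by exact: differentiable_sum.
have -> : average f = m.+2%:R^-1 \*: (\sum_(i < m.+2) f i).
  by apply/funext => z; rewrite /average /= fct_sumE.
apply/rowP => j; rewrite !mxE summxE diffZ//=.
rewrite -[in RHS]deriveE// derive_sum//; congr (_ * _).
by apply: eq_bigr => i _; rewrite mxE deriveE.
Qed.

Lemma rr_epochE (m : nat) (f : 'I_m.+2 -> 'rV[R]_d -> R) (eta : R) (p : 'S_m.+2)
    (y : 'rV[R]_d) :
  rr_epoch f eta p y = inner (fun c => grad (f c)) eta p y m.+2.
Proof.
have enumE : enum 'I_m.+2 = [seq inord i | i <- iota 0 m.+2].
  apply: (inj_map val_inj); rewrite val_enum_ord -map_comp -[LHS]map_id.
  apply/eq_in_map => i; rewrite mem_iota add0n => /andP[_ im] /=.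
  by rewrite inordK.
suff main k : foldl (fun x i => x - eta *: grad (f (p i)) x) y
    [seq inord i | i <- iota 0 k] = inner (fun c => grad (f c)) eta p y k.
  by rewrite /rr_epoch enumE main.
elim: k => // k IH.
by rewrite -[in iota _ _]addn1 iotaD map_cat foldl_cat IH add0n.
Qed.

End Average.

(** * Expectation over independent uniform permutations *)

Section Expectation.
Variables (R : realType) (disp : measure_display) (Omega : measurableType disp).
Variables (P : probability Omega R).

(** The events [A s] partition the space, the integrand is constant on each, and independence with
    uniformity gives each the same probability. *)
Lemma expectation_iid_perms (n K : nat) (sigma : nat -> Omega -> 'S_n)
    (h : {ffun 'I_K -> 'S_n} -> R) :
  iid_uniform_perms P K sigma -> (forall s, 0 <= h s) ->
  ('E_P[fun w => h [ffun k : 'I_K => sigma k w]] =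
  (#|{ffun 'I_K -> 'S_n}|%:R^-1 * \sum_s h s)%R%:E)%E.
Proof.
move=> [sigma_meas sigma_unif sigma_indep] h0.
pose A (s : {ffun 'I_K -> 'S_n}) :=
  [set w | forall k : 'I_K, sigma k w \in [set s k]%SET].
have mA s : measurable (A s).
  rewrite (_ : A s = \bigcap_(k in setT)
      [set w | sigma (k : 'I_K) w \in [set s k]%SET]).
    by apply: fin_bigcap_measurable => // k _; exact: sigma_meas.
  by apply/seteqP; split => [w Aw k _|w Aw k]; [exact: Aw | exact: (Aw k)].
have PA s : P (A s) = (#|{ffun 'I_K -> 'S_n}|%:R^-1)%:E.
  rewrite /A sigma_indep.
  under eq_bigr => k _.
    rewrite (_ : [set w | _] = [set w | sigma k w = s k]); last first.
      by apply/seteqP; split => w /=; rewrite inE => /eqP.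
    rewrite sigma_unif; over.
  rewrite prodEFin prodr_const card_ord card_ffun card_ord card_Sn natrX exprVn.
  by [].
have AE s w : \1_(A s) w = ([ffun k : 'I_K => sigma k w] == s)%:R :> R.
  rewrite indicE; congr (_%:R); congr nat_of_bool.
  apply/idP/eqP => [/set_mem Aw|ws]; last first.
    by apply/mem_set => k; rewrite -ws ffunE inE.
  by apply/ffunP => k; rewrite ffunE; have := Aw k; rewrite inE => /eqP.
rewrite unlock.
under eq_integral => w _.
  rewrite (_ : (h [ffun k : 'I_K => sigma k w])%:E =
      \sum_s ((h s)%:E * (\1_(A s) w)%:E)%E)%E; last first.
    rewrite (bigD1 [ffun k : 'I_K => sigma k w])//= AE eqxx mule1 big1 ?adde0// => s sw.
    by rewrite AE eq_sym (negbTE sw) mule0.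
  over.
rewrite ge0_integral_sum//; last 2 first.
- move=> s; apply: measurable_funeM; apply/measurable_realfun.measurable_EFinP.
  exact: measurable_realfun.measurable_indic.
- by move=> s w _; rewrite mule_ge0// lee_fin.
rewrite mulr_sumr -sumEFin; apply: eq_bigr => s _.
rewrite ge0_integralZl// ?lee_fin//.
  rewrite integral_indic// setIT mulrC EFinM; congr (_ * _)%E; exact: PA.
apply/measurable_realfun.measurable_EFinP; exact: measurable_realfun.measurable_indic.
Qed.

End Expectation.

(** * Assembling the final bound *)

Fact rate_arith (R : realFieldType) (a : R) :
  0 <= a -> a <= 1 / 32 -> 0 <= 3 / 4 * a <= 1.
Proof. by move=> a0 a1; apply/andP; split; lra. Qed.

Fact noise_ge0 (R : realFieldType) (L G mu e rho x : R) :
  0 <= L -> 0 <= G -> 0 <= mu -> 0 <= e -> 0 <= x ->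
  0 <= 64 * L ^+ 2 * G ^+ 2 / mu ^+ 2 * e ^+ 2
       + 6 * L ^+ 2 * G ^+ 2 / mu * x ^+ 2 * e ^+ 3
       + 8 * rho ^+ 2 * G ^+ 4 / (9 * mu ^+ 2) * x ^+ 2 * e ^+ 4.
Proof.
move=> L0 G0 mu0 e0 x0; move: (rho ^+ 2) (sqr_ge0 rho) => r r0.
by rewrite !(addr_ge0, mulr_ge0, invr_ge0, exprn_ge0).
Qed.

Theorem theorem3p4 (R : realType) (d n : nat) (hn : (2 <= n)%N)
    (f : 'I_n -> 'rV[R]_d -> R) (L mu rho eta : R) (xstar y0 : 'rV[R]_d)
    (hdiff : forall (i : 'I_n) (x : 'rV[R]_d), differentiable (f i) x)
    (hlip : forall i : 'I_n, lipschitz_gradient L (f i))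
    (hmu : 0 < mu) (hmuL : mu <= L)
    (hsc : strongly_convex mu (average f))
    (hmin : unique_minimizer (average f) xstar)
    (htwice : twice_differentiable (average f))
    (hhess : forall x y : 'rV[R]_d,
      opnorm (hessian (average f) x - hessian (average f) y) <=
        rho * enorm (x - y))
    (heta : 0 < eta) (hstep : n%:R * eta <= mu / (32 * L ^+ 2))
    (K : nat) (hK : (1 <= K)%N)
    (disp : measure_display) (Omega : measurableType disp)
    (P : probability Omega R) (sigma : nat -> Omega -> 'S_n)
    (hsigma : iid_uniform_perms P K sigma) :
  let T : R := (n * K)%:R in
  let D := Dconst f L xstar y0 in
  let G := Gconst f L xstar y0 in
  ('E_P[fun w => (enorm (rr f eta y0 (fun k => sigma k w) K - xstar) ^+ 2)%R] <=
    (expR (- (mu * eta * T / 2)) * D ^+ 2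
     + 64 * L ^+ 2 * G ^+ 2 / mu ^+ 2 * eta ^+ 2
     + 6 * L ^+ 2 * G ^+ 2 / mu * n%:R ^+ 2 * eta ^+ 3
     + 8 * rho ^+ 2 * G ^+ 4 / (9 * mu ^+ 2) * n%:R ^+ 2 * eta ^+ 4)%R%:E)%E.
Proof.
case: n hn f hdiff hlip hsc hmin htwice hhess hstep sigma hsigma => [|[|m]]// _ f
  hdiff hlip hsc [hmin _] htwice hhess hstep sigma hsigma /=.
set D := Dconst f L xstar y0; set G := Gconst f L xstar y0.
pose g c := grad (f c).
pose F := average f.
have FE x : mean_field g x = grad F x by exact: mean_field_grad.
have dF x : differentiable F x by have [] := htwice x.
have F_xs : mean_field g xstar = 0 by rewrite FE; exact: minimizer_grad0.
have F_mono x : mu * enorm (x - xstar) ^+ 2 <= dot (mean_field g x) (x - xstar).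
  by rewrite FE; exact: strongly_convex_grad_mono.
have g_xs c : enorm (g c xstar) <= Gstar f xstar.
  by rewrite /Gstar; exact: (le_bigmax _ (fun i => enorm (grad (f i) xstar))).
have D_ge : Gstar f xstar / (2 * L) <= D by rewrite /D /Dconst le_max lexx orbT.
have D_y0 : enorm (y0 - xstar) <= D by rewrite /D /Dconst le_max lexx.
(* The statement fixes no sign for [rho]; the final bound contains only its square, so its absolute
   value serves as well. *)
have hhess' x y : opnorm (hessian F x - hessian F y) <= `|rho| * enorm (x - y).
  by apply: le_trans (hhess x y) _; rewrite ler_wpM2r ?enorm_ge0 ?ler_norm.
have taylor x e : enorm (mean_field g (x + e) - mean_field g x - e *m hessian F x)
    <= `|rho| / 2 * enorm e ^+ 2.
  by rewrite !FE; exact: grad_taylor.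
have L_gt0 : 0 < L by exact: lt_le_trans hmuL.
have H_le x e : enorm (e *m hessian F x) <= L * enorm e.
  by apply: (linear_part_le _ (mean_field_lip hlip) (taylor x)); rewrite divr_ge0.
have trajectory_rr (s : nat -> 'S_m.+2) k :
    trajectory (rr_epoch f eta) y0 s k = rr f eta y0 s k.
  by elim: k => //= k ->.
pose phi x := enorm (x - xstar) ^+ 2.
pose h (s : {ffun 'I_K -> 'S_m.+2}) :=
  phi (trajectory (rr_epoch f eta) y0 (extend 1%g s) K).
have -> : (fun w => (enorm (rr f eta y0 (fun k => sigma k w) K - xstar) ^+ 2)%R) =
    fun w => h [ffun k : 'I_K => sigma k w].
  apply/funext => w; rewrite -trajectory_rr /h /phi; congr (enorm (_ - _) ^+ 2).
  by apply: eq_trajectory => j jK; rewrite /extend insubT ffunE.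
rewrite expectation_iid_perms//; last by move=> s; exact: sqr_ge0.
rewrite lee_fin.
pose q := 3 / 4 * (m.+2%:R * eta * mu).
pose B := 64 * L ^+ 2 * G ^+ 2 / mu ^+ 2 * eta ^+ 2
     + 6 * L ^+ 2 * G ^+ 2 / mu * m.+2%:R ^+ 2 * eta ^+ 3
     + 8 * rho ^+ 2 * G ^+ 4 / (9 * mu ^+ 2) * m.+2%:R ^+ 2 * eta ^+ 4.
have D0 : 0 <= D by exact: le_trans (enorm_ge0 _) D_y0.
have G0 : 0 <= G.
  rewrite /G /Gconst addr_ge0//; last by rewrite mulr_ge0// mulr_ge0// ltW.
  exact: le_trans (enorm_ge0 _) (g_xs ord0).
have e0 := ltW heta.
have mu0 := ltW hmu.
have L0 := ltW L_gt0.
have B0 : 0 <= B by exact: noise_ge0.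
have rate0 : 0 <= m.+2%:R * eta * mu by rewrite mulr_ge0// mulr_ge0.
have q01 : 0 <= q <= 1.
  have := epoch_rate_le hmu hmuL heta hstep.
  by rewrite /q; apply: rate_arith.
have invstep p x : enorm (x - xstar) <= D -> enorm (rr_epoch f eta p x - xstar) <= D.
  move=> xD; rewrite rr_epochE.
  exact: (inner_end hmu hmuL heta hstep hlip F_xs F_mono g_xs D_ge).
have phistep x : enorm (x - xstar) <= D ->
   \sum_p phi (rr_epoch f eta p x) <= #|{: 'S_m.+2}|%:R * ((1 - q) * phi x + q * B).
  move=> xD; under eq_bigr do rewrite rr_epochE.
  have := one_epoch hmu hmuL heta hstep hlip F_xs F_mono g_xs D_ge
    (normr_ge0 rho) taylor H_le xD.
  by rewrite real_normK ?num_real.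
have final := @sum_trajectory_le R {perm 'I_m.+2} 'rV[R]_d K (rr_epoch f eta) y0 1%g
  (fun x => enorm (x - xstar) <= D) phi q B D_y0 invstep phistep q01 B0.
rewrite ler_pdivrMl; last by rewrite ltr0n; apply/card_gt0P; exists [ffun=> 1%g].
apply: le_trans final _.
rewrite ler_wpM2l// -!addrA lerD//; last by rewrite /B !addrA.
have /andP[_ q1] := q01.
apply: ler_pM; rewrite ?exprn_ge0 ?subr_ge0 ?q1 ?enorm_ge0//; last first.
  by rewrite lerXn2r ?nnegrE ?enorm_ge0.
have -> : - (mu * eta * (m.+2 * K)%:R / 2) = K%:R * - (m.+2%:R * eta * mu / 2).
  by rewrite natrM; ring.
rewrite expRM_natl lerXn2r ?nnegrE ?subr_ge0 ?expR_ge0 ?q1//.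
(* With a = n eta mu, 1 - 3/4 a <= 1 - a/2 <= exp(-a/2). *)
rewrite (le_trans _ (expR_ge1Dx _))// lerD2l lerN2 /q.
by move: (m.+2%:R * eta * mu) rate0 => a; clear; lra.
Qed.
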